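(* Suppose the graph assumption, the function assumption, the Bregman–Lipschitz assumption, the contractivity assumption, Slater's condition and the strong convexity assumption (all defined in the context) hold. Let $\kappa\in(0,1)$. For any $T\in\mathbb{N}_+$, let $\boldsymbol{x}_T=(x_1,\dots,x_T)$ be the sequence generated by the algorithm described in the context with all $\Phi_{i,t}$ being the identity mapping and $$\alpha_t=\frac{1}{t^{\max\{1-\kappa,\kappa\}}},\quad \beta_t=\frac{1}{t^{\kappa}},\quad \gamma_t=\frac{1}{t^{1-\kappa}},\quad \forall t\in\mathbb{N}_+ .$$ Then $$\mathrm{Reg}(\boldsymbol{x}_T,\check{\boldsymbol{x}}^*_T)\le \max\{C_1,C_{4}\}\,T^{\kappa},$$ $$\Big\|\Big[\sum_{t=1}^Tg_{t}(x_{t})\Big]_+\Big\|\le \sqrt{C_{2}}\,T^{1-\kappa/2},$$ where $C_4=\frac{n(B_1)^2}{2\kappa}+\frac{B_1C_{1,1}}{\kappa}+\frac{C_{1,2}}{\kappa}+2n\,d(X)K(B_4)^{1-\kappa}$, $B_4=\big\lceil \underline{\mu}^{-1/\kappa}\big\rceil$, $\underline{\mu}=\min\{\mu_1,\dots,\mu_n\}$, and, with $c=\max\{1-\kappa,\kappa\}$, $C_1=\frac{C_{1,1}}{\kappa}+\frac{C_{1,2}}{1-c}+2n\,d(X)K$, $C_{2,1}=2n\big(\frac{2G^2}{(1-c)\underline{\sigma}}+\frac{1}{1-\kappa}+2\big)$, $C_{2}=C_{2,1}(2nF+C_1)$ are constants independent of $T$.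
   Context: Problem. There are $n$ agents, $[n]=\{1,\dots,n\}$. For each $i\in[n]$, $X_i\subseteq\mathbb{R}^{p_i}$ is closed and convex; $X=X_1\times\cdots\times X_n$, and points of $X$ are written $x_t=\mathrm{col}(x_{1,t},\dots,x_{n,t})$. For $t\in\mathbb{N}_+$, $f_{i,t},r_{i,t}:X_i\to\mathbb{R}$ and $g_{i,t}:X_i\to\mathbb{R}^m$ are convex (componentwise for $g_{i,t}$). Put $f_t(x)=\sum_{i=1}^n(f_{i,t}(x_i)+r_{i,t}(x_i))$ and $g_t(x)=\sum_{i=1}^n g_{i,t}(x_i)$. Vector inequalities are componentwise, $[\cdot]_+$ is the componentwise projection onto the nonnegative orthant, $\|\cdot\|$ is the Euclidean norm (induced 2-norm for matrices). Let $\mathcal{X}_T=\{(x_1,\dots,x_T): x_t\in X,\ g_t(x_t)\le \mathbf{0}_m,\ t=1,\dots,T\}$ and $\check{\mathcal{X}}_T=\{(x,\dots,x): x\in X,\ g_t(x)\le\mathbf{0}_m,\ t=1,\dots,T\}\subseteq\mathcal{X}_T$, assumed nonempty for every $T\in\mathbb{N}_+$. The regret of $\boldsymbol{x}_T=(x_1,\dots,x_T)$ with respect to $\boldsymbol{y}_T=(y_1,\dots,y_T)\in\mathcal{X}_T$ is $\mathrm{Reg}(\boldsymbol{x}_T,\boldsymbol{y}_T)=\sum_{t=1}^Tf_t(x_t)-\sum_{t=1}^Tf_t(y_t)$. $\check{\boldsymbol{x}}^*_T\in\arg\min_{\boldsymbol{x}_T\in\check{\mathcal{X}}_T}\sum_{t=1}^Tf_t(x_t)$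 is the static optimal sequence. Subgradients. $\nabla f(x)$ denotes a (fixed choice of) subgradient of a convex function $f$ on its domain at $x$ (the gradient if differentiable), i.e. $f(y)\ge f(x)+\langle\nabla f(x),y-x\rangle$ for all $y$ in the domain; for a vector function, $\nabla g(x)\in\mathbb{R}^{m\times p}$ has as rows the transposed subgradients of the components. Bregman divergence. For each $i$, $\psi_i:X_i\to\mathbb{R}$ is differentiable and strongly convex with parameter $\sigma_i>0$, i.e. $\psi_i(x)\ge\psi_i(y)+\langle\nabla\psi_i(y),x-y\rangle+\frac{\sigma_i}{2}\|x-y\|^2$; $\mathcal{D}_{\psi_i}(x,y)=\psi_i(x)-\psi_i(y)-\langle\nabla\psi_i(y),x-y\rangle$; $\underline{\sigma}=\min_i\sigma_i$. Algorithm. Given positive non-increasing sequences $\{\alpha_t\},\{\beta_t\},\{\gamma_t\}$, maps $\Phi_{i,t}:X_i\to X_i$, and matrices $W_t\in\mathbb{R}^{n\times n}$. Initialize with arbitrary $x_{i,0}\in X_i$, $f_{i,0}=r_{i,0}\equiv0$, $g_{i,0}\equiv\mathbf{0}_m$, $q_{i,0}=\mathbf{0}_m$. For $t=1,2,\dots$ and each $i\in[n]$: $\tilde q_{i,t}=\sum_{j=1}^n[W_{t-1}]_{ij}q_{j,t-1}$; $a_{i,t}=\nabla f_{i,t-1}(x_{i,t-1})+(\nabla g_{i,t-1}(x_{i,t-1}))^\top\tilde q_{i,t}$; $\tilde x_{i,t}=\arg\min_{x\in X_i}\{\alpha_t\langle x,a_{i,t}\rangle+\alpha_tr_{i,t-1}(x)+\mathcal{D}_{\psi_i}(x,x_{i,t-1})\}$;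 $b_{i,t}=\nabla g_{i,t-1}(x_{i,t-1})(\tilde x_{i,t}-x_{i,t-1})+g_{i,t-1}(x_{i,t-1})$; $q_{i,t}=[\tilde q_{i,t}+\gamma_t(b_{i,t}-\beta_t\tilde q_{i,t})]_+$; $x_{i,t}=\Phi_{i,t}(\tilde x_{i,t})$. Graph assumption. At time $t$ the agents communicate over a directed graph $\mathcal{G}_t=([n],\mathcal{E}_t)$; $[W_t]_{ij}>0$ if $(j,i)\in\mathcal{E}_t$ or $i=j$, and $[W_t]_{ij}=0$ otherwise. For every $t\in\mathbb{N}_+$: (1) there is a constant $w\in(0,1)$ with $[W_t]_{ij}\ge w$ whenever $[W_t]_{ij}>0$; (2) $W_t$ is doubly stochastic; (3) there is an integer $\iota>0$ such that the graph $([n],\cup_{l=0}^{\iota-1}\mathcal{E}_{t+l})$ is strongly connected. ($w$ and $\iota$ do not depend on $t$.) Function assumption. (1) Each $X_i$ is convex and compact; (2) $f_{i,t},r_{i,t},g_{i,t}$ are convex and there is $F>0$ with $\|f_{i,t}(x)\|,\|r_{i,t}(x)\|,\|g_{i,t}(x)\|\le F$ for all $t\in\mathbb{N}_+,i\in[n],x\in X_i$; (3) the subgradients exist and there is $G>0$ with $\|\nabla f_{i,t}(x)\|,\|\nabla r_{i,t}(x)\|,\|\nabla g_{i,t}(x)\|\le G$ for all such $t,i,x$. Bregman–Lipschitz assumption. There is $K>0$ with $|\mathcal{D}_{\psi_i}(x_1,y)-\mathcal{D}_{\psi_i}(x_2,y)|\le K\|x_1-x_2\|$ for all $i\in[n]$,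 $x_1,x_2,y\in X_i$. Contractivity assumption. $\mathcal{D}_{\psi_i}(\Phi_{i,t}(x),\Phi_{i,t}(y))\le\mathcal{D}_{\psi_i}(x,y)$ for all $t\in\mathbb{N}_+$, $i\in[n]$, $x,y\in X_i$ (trivially true for identity mappings). Slater's condition. There exist $\varepsilon>0$ and $x_0\in X$ with $g_t(x_0)\le-\varepsilon\mathbf{1}_m$ for all $t\in\mathbb{N}_+$. Strong convexity assumption. For every $i\in[n]$ there is $\mu_i>0$ such that for all $t\in\mathbb{N}_+$, $f_{i,t}$ is $\mu_i$-strongly convex over $X_i$ with respect to $\psi_i$: $f_{i,t}(x)\ge f_{i,t}(y)+\langle x-y,\nabla f_{i,t}(y)\rangle+\mu_i\mathcal{D}_{\psi_i}(x,y)$ for all $x,y\in X_i$. Further notation. $d(X)>0$ is a constant with $\|x-y\|\le d(X)$ for all $x,y\in X$. Constants: $\tau=(1-\frac{w}{2n^2})^{-2}$, $\lambda=(1-\frac{w}{2n^2})^{1/\iota}$, $B_1=2F+Gd(X)$, $C_{1,1}=\frac{3n^2\tau B_1F}{1-\lambda}+\frac{n(B_1)^2}{2}$, $C_{1,2}=\frac{4nG^2}{\underline{\sigma}}$. *)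

(* Defs.v *)
From HB Require Import structures.
From mathcomp Require Export all_boot all_order all_algebra.
From mathcomp Require Export all_classical all_reals all_analysis.

Set Implicit Arguments.
Unset Strict Implicit.
Unset Printing Implicit Defensive.

Import Order.TTheory GRing.Theory Num.Theory.
Import numFieldNormedType.Exports.

Local Open Scope classical_set_scope.
Local Open Scope ring_scope.

Section Euclidean.
Context {R : realType}.

(* The norm `|_| that the library puts on matrices is the sup norm; the
   Euclidean and induced 2-norms are therefore defined here.  Both norms give
   the same topology, so [compact], [closed], [nbhs] are the library's. *)
Definition dot p (u v : 'cV[R]_p) : R := \sum_k u k 0 * v k 0.

Definition enorm p (u : 'cV[R]_p) : R := Num.sqrt (dot u u).

Definition opnorm m p (A : 'M[R]_(m, p)) : R :=
  sup [set enorm (A *m v) | v in [set v | enorm v <= 1]].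

Definition pos p (u : 'cV[R]_p) : 'cV[R]_p := map_mx (Num.max 0) u.

Definition vmin n (n_gt0 : (0 < n)%N) (a : 'I_n -> R) : R :=
  \big[Num.min/a (Ordinal n_gt0)]_(i < n) a i.

Definition is_argmin (T : Type) (A : set T) (h : T -> R) (z : T) : Prop :=
  A z /\ forall z', A z' -> h z <= h z'.

Definition is_subgradient p (A : set 'cV[R]_p) (h : 'cV[R]_p -> R)
    (y v : 'cV[R]_p) : Prop :=
  forall x, A x -> h y + dot v (x - y) <= h x.

(* Frechet differentiability at y, with gradient v, of h as a function on A:
   x tends to y inside A only, so the values of h outside A are irrelevant. *)
Definition is_gradient p (A : set 'cV[R]_p) (h : 'cV[R]_p -> R)
    (y v : 'cV[R]_p) : Prop :=
  (h x - h y - dot v (x - y)) / enorm (x - y) @[x --> within A y^'] --> (0 : R).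

Definition doubly_stochastic n (A : 'M[R]_n) : Prop :=
  [/\ forall i j, 0 <= A i j,
      forall i, \sum_j A i j = 1 &
      forall j, \sum_i A i j = 1].

End Euclidean.

(* The data of the problem.  A function on X_i is represented by a total
   function on R^{p_i} of which only the values on X_i are ever constrained or
   used.  [dloss], [drgl], [dcon] are the fixed choices of subgradients, [dpsi]
   is the gradient of psi_i.  Index t = 0 is the dummy round used only by the
   initialization of the algorithm (see [run_zero]). *)
Record problem (R : realType) (n m : nat) := Problem {
  dim : 'I_n -> nat;
  dom : forall i, set 'cV[R]_(dim i);
  loss : forall i, nat -> 'cV[R]_(dim i) -> R;
  rgl : forall i, nat -> 'cV[R]_(dim i) -> R;
  con : forall i, nat -> 'cV[R]_(dim i) -> 'cV[R]_m;
  dloss : forall i, nat -> 'cV[R]_(dim i) -> 'cV[R]_(dim i);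
  drgl : forall i, nat -> 'cV[R]_(dim i) -> 'cV[R]_(dim i);
  dcon : forall i, nat -> 'cV[R]_(dim i) -> 'M[R]_(m, dim i);
  psi : forall i, 'cV[R]_(dim i) -> R;
  dpsi : forall i, 'cV[R]_(dim i) -> 'cV[R]_(dim i)
}.

Arguments dim {R n m} P i : rename.
Arguments dom {R n m} P i _ : rename.
Arguments loss {R n m} P i t _ : rename.
Arguments rgl {R n m} P i t _ : rename.
Arguments con {R n m} P i t _ : rename.
Arguments dloss {R n m} P i t _ : rename.
Arguments drgl {R n m} P i t _ : rename.
Arguments dcon {R n m} P i t _ : rename.
Arguments psi {R n m} P i _ : rename.
Arguments dpsi {R n m} P i _ : rename.

Section Problem.
Context {R : realType} {n m : nat}.
Variable P : problem R n m.

(* col(x_1, ..., x_n) *)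
Definition profile : Type := forall i, 'cV[R]_(dim P i).

Definition inX (x : profile) : Prop := forall i, dom P i (x i).

Definition pdist (x y : profile) : R :=
  Num.sqrt (\sum_i enorm (x i - y i) ^+ 2).

Definition tot_loss (t : nat) (x : profile) : R :=
  \sum_i (loss P i t (x i) + rgl P i t (x i)).

Definition tot_con (t : nat) (x : profile) : 'cV[R]_m := \sum_i con P i t (x i).

(* A sequence (x_1, ..., x_T) is the restriction to 1 <= t <= T of a sequence
   indexed by nat. *)
Definition feasible (T : nat) : set (nat -> profile) :=
  [set y | forall t, (1 <= t <= T)%N ->
     inX (y t) /\ forall k, tot_con t (y t) k 0 <= 0].

Definition static_feasible (T : nat) : set (nat -> profile) :=
  [set y | exists z : profile,
     [/\ inX z,
         forall t, (1 <= t <= T)%N -> forall k, tot_con t z k 0 <= 0 &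
         forall t, (1 <= t <= T)%N -> y t = z]].

Lemma static_feasible_sub (T : nat) : static_feasible T `<=` feasible T.
Proof.
by move=> y [z [Xz gz yz]] t tT; rewrite yz//; split => // k; exact: gz.
Qed.

Definition cum_loss (T : nat) (y : nat -> profile) : R :=
  \sum_(1 <= t < T.+1) tot_loss t (y t).

Definition regret (T : nat) (x y : nat -> profile) : R :=
  cum_loss T x - cum_loss T y.

Definition static_optimal (T : nat) (y : nat -> profile) : Prop :=
  is_argmin (static_feasible T) (cum_loss T) y.

Definition bregman (i : 'I_n) (x y : 'cV[R]_(dim P i)) : R :=
  psi P i x - psi P i y - dot (dpsi P i y) (x - y).

Definition mirror_map (sigma : 'I_n -> R) : Prop :=
  forall i, [/\ 0 < sigma i,
    forall y, dom P i y ->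
      is_gradient (dom P i) (psi P i) y (dpsi P i y) &
    forall x y, dom P i x -> dom P i y ->
      psi P i y + dot (dpsi P i y) (x - y) + sigma i / 2 * enorm (x - y) ^+ 2
        <= psi P i x].

Record standing_assumption (sigma : 'I_n -> R) : Prop := StandingAssumption {
  sa_closed : forall i, closed (dom P i);
  sa_mirror : mirror_map sigma;
  sa_feasible : forall T, (0 < T)%N -> static_feasible T !=set0
}.

Record function_assumption (F G : R) : Prop := FunctionAssumption {
  fa_F_gt0 : 0 < F;
  fa_G_gt0 : 0 < G;
  fa_convex_set : forall i, convex_set (dom P i);
  fa_compact : forall i, compact (dom P i);
  fa_convex : forall i t, (0 < t)%N ->
    [/\ convex_function (dom P i) (loss P i t),
        convex_function (dom P i) (rgl P i t) &
        forall k, convex_function (dom P i)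
          (fun x => con P i t x k 0)];
  fa_bounded : forall i t (x : 'cV[R]_(dim P i)), (0 < t)%N -> dom P i x ->
    [/\ `|loss P i t x| <= F, `|rgl P i t x| <= F & enorm (con P i t x) <= F];
  fa_subgradient : forall i t (x : 'cV[R]_(dim P i)), (0 < t)%N -> dom P i x ->
    [/\ is_subgradient (dom P i) (loss P i t) x (dloss P i t x),
        is_subgradient (dom P i) (rgl P i t) x (drgl P i t x) &
        forall k, is_subgradient (dom P i) (fun z => con P i t z k 0) x
          (row k (dcon P i t x))^T];
  fa_gradient_bounded : forall i t (x : 'cV[R]_(dim P i)), (0 < t)%N ->
    dom P i x ->
    [/\ enorm (dloss P i t x) <= G, enorm (drgl P i t x) <= G &
        opnorm (dcon P i t x) <= G]
}.

Definition bregman_lipschitz (K : R) : Prop :=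
  0 < K /\ forall i (x1 x2 y : 'cV[R]_(dim P i)),
    dom P i x1 -> dom P i x2 -> dom P i y ->
    `|bregman x1 y - bregman x2 y| <= K * enorm (x1 - x2).

Definition self_maps : Type :=
  forall i, nat -> 'cV[R]_(dim P i) -> 'cV[R]_(dim P i).

Definition preserves_dom (Phi : self_maps) : Prop :=
  forall i t x, (0 < t)%N -> dom P i x -> dom P i (Phi i t x).

Definition contractive (Phi : self_maps) : Prop :=
  forall i t x y, (0 < t)%N -> dom P i x -> dom P i y ->
    bregman (Phi i t x) (Phi i t y) <= bregman x y.

Definition slater : Prop :=
  exists eps : R, exists x0 : profile,
    [/\ 0 < eps, inX x0 &
        forall t, (0 < t)%N -> forall k, tot_con t x0 k 0 <= - eps].

Definition strongly_convex_losses (mu : 'I_n -> R) : Prop :=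
  forall i, 0 < mu i /\
    forall t (x y : 'cV[R]_(dim P i)), (0 < t)%N -> dom P i x -> dom P i y ->
      loss P i t y + dot (x - y) (dloss P i t y) + mu i * bregman x y
        <= loss P i t x.

(* E t j i means that (j, i) is an edge of the graph at time t. *)
Definition graph_assumption (E : nat -> rel 'I_n) (W : nat -> 'M[R]_n)
    (w : R) (iota : nat) : Prop :=
  [/\ 0 < w < 1, (0 < iota)%N &
  forall t, (0 < t)%N ->
    [/\ forall i j, E t j i || (i == j) -> 0 < W t i j,
        forall i j, ~~ (E t j i || (i == j)) -> W t i j = 0,
        forall i j, 0 < W t i j -> w <= W t i j,
        doubly_stochastic (W t) &
        forall a b : 'I_n,
          connect [rel j i | [exists l : 'I_iota, E (t + l)%N j i]] a b]].

Section Algorithm.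
Variables (W : nat -> 'M[R]_n) (Phi : self_maps) (alpha beta gamma : nat -> R).
Variables (x xt : nat -> profile) (q : nat -> 'I_n -> 'cV[R]_m).

(* In the next three definitions the first argument is t - 1. *)
Definition q_tilde (s : nat) (i : 'I_n) : 'cV[R]_m :=
  \sum_j W s i j *: q s j.

Definition descent_dir (s : nat) (i : 'I_n) : 'cV[R]_(dim P i) :=
  dloss P i s (x s i) + (dcon P i s (x s i))^T *m q_tilde s i.

Definition con_lin (s : nat) (i : 'I_n) : 'cV[R]_m :=
  dcon P i s (x s i) *m (xt s.+1 i - x s i) + con P i s (x s i).

Record algorithm_run : Prop := AlgorithmRun {
  run_x0 : inX (x 0%N);
  run_q0 : forall i, q 0%N i = 0;
  run_zero : forall i (z : 'cV[R]_(dim P i)), dom P i z ->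
    [/\ loss P i 0 z = 0, rgl P i 0 z = 0, con P i 0 z = 0,
        dloss P i 0 z = 0 & dcon P i 0 z = 0];
  run_xt : forall s i, is_argmin (dom P i)
    (fun z => alpha s.+1 * dot z (descent_dir s i)
              + alpha s.+1 * rgl P i s z + bregman z (x s i))
    (xt s.+1 i);
  run_q : forall s i, q s.+1 i =
    pos (q_tilde s i
         + gamma s.+1 *: (con_lin s i - beta s.+1 *: q_tilde s i));
  run_x : forall s i, x s.+1 i = Phi s.+1 (xt s.+1 i)
}.

End Algorithm.
End Problem.

(* Main.v *)
(* Per round, the first-order optimality of the mirror step and the
   nonexpansiveness of the dual projection are added; the terms containing
   dcon (x_(t+1) - x_t) paired with q~_t cancel, and what remains telescopes up
   to the pairing of q~_t with the constraints at the comparator.  Splitting q~_t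
   into its network average (which pairs nonpositively with a feasible point) and
   the disagreement leaves the consensus error alone.

   That error is summed over time using a contraction of the Euclidean norm of
   mean-zero vectors by 1 - w / n^3 per window of iota rounds: some cut separates
   the values by a gap of at least range / n, and the first weight crossing this
   cut decreases the squared norm by at least w gap^2 / 2.  The resulting bound is at most
   one sixth of the first summand of C11 (a constant in which tau / (1 - lambda) is
   at least 2 n^2 iota / w).

   For kappa >= 1/2 the regret is at most C1 T^kappa.  For kappa < 1/2 strong
   convexity absorbs the growth of 1 / alpha_t from round B4 on and the regret is
   at most (C1 + C4) / 2 T^kappa; the average is essential, C4 alone does not
   dominate the consensus error when B1 is small.  The constraint violation
   follows by choosing the dual comparator proportional to the positive part of
   the accumulated constraints. *)

Require Import Defs.
From mathcomp Require Import all_boot all_order all_algebra.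
From mathcomp Require Import all_classical all_reals all_analysis.
From mathcomp Require Import ring lra zify.

Set Implicit Arguments.
Unset Strict Implicit.
Unset Printing Implicit Defensive.

Import Order.TTheory GRing.Theory Num.Theory.
Import numFieldNormedType.Exports.

Local Open Scope classical_set_scope.
Local Open Scope ring_scope.


(** * Euclidean and operator norms *)

Section SquareSums.
Context {R : realType} {I : finType}.
Implicit Types f g : I -> R.

(** Over an arbitrary finite index type, so that the Euclidean norm, the Frobenius norm (indexed by
    pairs) and the vector of row norms of a matrix share the inequalities below. *)
Definition l2norm f : R := Num.sqrt (\sum_i f i ^+ 2).

Lemma sumsq_ge0 f : 0 <= \sum_i f i ^+ 2.
Proof. by apply: sumr_ge0 => i _; exact: sqr_ge0. Qed.

Lemma l2norm_ge0 f : 0 <= l2norm f.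
Proof. exact: sqrtr_ge0. Qed.

Lemma l2normE f : l2norm f ^+ 2 = \sum_i f i ^+ 2.
Proof. by rewrite sqr_sqrtr ?sumsq_ge0. Qed.

(** Lagrange's identity: the defect is half the double sum of the squares of
    [f i * g j - f j * g i]. *)
Lemma cauchy_schwarz_sq f g :
  (\sum_i f i * g i) ^+ 2 <= (\sum_i f i ^+ 2) * (\sum_i g i ^+ 2).
Proof.
have H : 0 <= \sum_i \sum_j (f i * g j - f j * g i) ^+ 2.
  by apply: sumr_ge0 => i _; apply: sumr_ge0 => j _; exact: sqr_ge0.
have E : \sum_i \sum_j (f i * g j - f j * g i) ^+ 2 =
    2 * ((\sum_i f i ^+ 2) * (\sum_i g i ^+ 2) - (\sum_i f i * g i) ^+ 2).
  transitivity (\sum_i \sum_j (f i ^+ 2 * g j ^+ 2)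
    + \sum_i \sum_j (g i ^+ 2 * f j ^+ 2)
    - 2 * \sum_i \sum_j ((f i * g i) * (f j * g j))).
    rewrite mulr_sumr -big_split -sumrB /=; apply: eq_bigr => i _.
    rewrite mulr_sumr -big_split -sumrB /=; apply: eq_bigr => j _.
    by ring.
  rewrite -!big_distrlr /=; ring.
lra.
Qed.

Lemma cauchy_schwarz_l2 f g : \sum_i f i * g i <= l2norm f * l2norm g.
Proof.
rewrite (le_trans (ler_norm _))// -sqrtr_sqr -sqrtrM ?sumsq_ge0//.
by rewrite ler_wsqrtr// cauchy_schwarz_sq.
Qed.

Lemma l2normD f g : l2norm (fun i => f i + g i) <= l2norm f + l2norm g.
Proof.
rewrite -(@ler_pXn2r _ 2)// ?nnegrE ?addr_ge0 ?l2norm_ge0// sqrrD !l2normE.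
have -> : \sum_i (f i + g i) ^+ 2
    = \sum_i f i ^+ 2 + (\sum_i f i * g i) *+ 2 + \sum_i g i ^+ 2.
  by rewrite -sumrMnl -!big_split /=; apply: eq_bigr => i _; rewrite sqrrD.
by rewrite lerD2r lerD2l lerMn2r/= cauchy_schwarz_l2.
Qed.

Lemma l2normZ a f : l2norm (fun i => a * f i) = `|a| * l2norm f.
Proof.
rewrite /l2norm -sqrtr_sqr -sqrtrM ?sqr_ge0// mulr_sumr.
by under eq_bigr do rewrite exprMn.
Qed.

Lemma ler_l2norm f g : (forall i, `|f i| <= `|g i|) -> l2norm f <= l2norm g.
Proof.
move=> fg; rewrite ler_wsqrtr// ler_sum// => i _.
by rewrite -(real_normK (num_real (f i))) -(real_normK (num_real (g i)))
  lerXn2r ?nnegrE.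
Qed.

End SquareSums.

Section EuclideanNorm.
Context {R : realType}.

Section Vectors.
Context {p : nat}.
Implicit Types u v : 'cV[R]_p.

Lemma enormE u : enorm u = l2norm (fun k => u k 0).
Proof. by rewrite /enorm /dot /l2norm; under eq_bigr do rewrite -expr2. Qed.

Lemma dotE u v : dot u v = (u^T *m v) 0 0.
Proof. by rewrite mxE; apply: eq_bigr => k _; rewrite mxE. Qed.

Lemma dotC u v : dot u v = dot v u.
Proof. by apply: eq_bigr => k _; rewrite mulrC. Qed.

Lemma dotDl u u' v : dot (u + u') v = dot u v + dot u' v.
Proof. by rewrite !dotE linearD /= mulmxDl mxE. Qed.

Lemma dot0l u : dot 0 u = 0.
Proof. by rewrite dotE trmx0 mul0mx mxE. Qed.

Lemma dot0r u : dot u 0 = 0.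
Proof. by rewrite dotC dot0l. Qed.

Lemma dotNl u v : dot (- u) v = - dot u v.
Proof. by rewrite !dotE linearN /= mulNmx mxE. Qed.

Lemma dotBl u u' v : dot (u - u') v = dot u v - dot u' v.
Proof. by rewrite dotDl dotNl. Qed.

Lemma dotZl a u v : dot (a *: u) v = a * dot u v.
Proof. by rewrite !dotE linearZ /= -scalemxAl mxE. Qed.

Lemma dotDr u v v' : dot u (v + v') = dot u v + dot u v'.
Proof. by rewrite dotC dotDl !(dotC u). Qed.

Lemma dotNr u v : dot u (- v) = - dot u v.
Proof. by rewrite dotC dotNl dotC. Qed.

Lemma dotBr u v v' : dot u (v - v') = dot u v - dot u v'.
Proof. by rewrite dotDr dotNr. Qed.

Lemma dotZr a u v : dot u (a *: v) = a * dot u v.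
Proof. by rewrite dotC dotZl dotC. Qed.

Lemma dot_suml (I : Type) (r : seq I) (h : I -> 'cV[R]_p) v :
  dot (\sum_(i <- r) h i) v = \sum_(i <- r) dot (h i) v.
Proof.
by rewrite dotE linear_sum mulmx_suml summxE; apply: eq_bigr => i _; rewrite dotE.
Qed.

Lemma dot_sumr (I : Type) (r : seq I) (h : I -> 'cV[R]_p) v :
  dot v (\sum_(i <- r) h i) = \sum_(i <- r) dot v (h i).
Proof. by rewrite dotC dot_suml; apply: eq_bigr => i _; rewrite dotC. Qed.

Lemma dotuu u : dot u u = enorm u ^+ 2.
Proof. by rewrite enormE l2normE; apply: eq_bigr => k _; rewrite expr2. Qed.

Lemma enorm_ge0 u : 0 <= enorm u.
Proof. exact: sqrtr_ge0. Qed.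

Lemma enorm0 : enorm (0 : 'cV[R]_p) = 0.
Proof.
by rewrite /enorm /dot big1 ?sqrtr0// => k _; rewrite mxE mulr0.
Qed.

Lemma enorm_eq0 u : (enorm u == 0) = (u == 0).
Proof.
apply/idP/eqP => [|->]; last by rewrite enorm0.
rewrite sqrtr_eq0 => u0; apply/matrixP => k j; rewrite (ord1 j) mxE.
have uk0 (i : 'I_p) : 0 <= u i 0 * u i 0 by rewrite -expr2 sqr_ge0.
have : dot u u == 0 by rewrite eq_le u0 sumr_ge0.
rewrite psumr_eq0// => /allP/(_ k); rewrite mem_index_enum => /(_ isT) /=.
by rewrite -expr2 sqrf_eq0 => /eqP.
Qed.

Lemma enorm_gt0 u : (0 < enorm u) = (u != 0).
Proof. by rewrite lt_neqAle enorm_ge0 andbT eq_sym enorm_eq0. Qed.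

Lemma ler_dot u v : dot u v <= enorm u * enorm v.
Proof. by rewrite !enormE cauchy_schwarz_l2. Qed.

Lemma enormD u v : enorm (u + v) <= enorm u + enorm v.
Proof.
rewrite !enormE (le_trans _ (l2normD _ _))//.
by rewrite ler_l2norm// => k; rewrite mxE.
Qed.

Lemma enormZ a u : enorm (a *: u) = `|a| * enorm u.
Proof.
by rewrite !enormE -l2normZ /l2norm; under eq_bigr do rewrite mxE.
Qed.

Lemma enormN u : enorm (- u) = enorm u.
Proof. by rewrite -scaleN1r enormZ normrN1 mul1r. Qed.

Lemma enormB u v : enorm (u - v) <= enorm u + enorm v.
Proof. by rewrite -(enormN v) enormD. Qed.

Lemma enorm_sum (I : Type) (r : seq I) (h : I -> 'cV[R]_p) :
  enorm (\sum_(i <- r) h i) <= \sum_(i <- r) enorm (h i).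
Proof.
elim/big_ind2: _ => [|x1 x2 y1 y2 le1 le2|//]; first by rewrite enorm0.
by rewrite (le_trans (enormD _ _))// lerD.
Qed.

Lemma enormB_sq u v :
  enorm (u - v) ^+ 2 = enorm u ^+ 2 - 2 * dot u v + enorm v ^+ 2.
Proof. by rewrite -!dotuu dotBl !dotBr (dotC v u); ring. Qed.

Lemma posE u k : pos u k 0 = Num.max 0 (u k 0).
Proof. by rewrite mxE. Qed.

Lemma enorm_pos_le u : enorm (pos u) <= enorm u.
Proof.
rewrite !enormE ler_l2norm// => k; rewrite posE.
by rewrite /Num.max; case: ifPn => // _; rewrite normr0.
Qed.

Lemma ler_enorm u v : (forall k, 0 <= u k 0 <= v k 0) -> enorm u <= enorm v.
Proof.
move=> uv; rewrite !enormE ler_l2norm// => k; have /andP[u0 le_uv] := uv k.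
by rewrite !ger0_norm// (le_trans u0).
Qed.

Lemma ler_dot_pos u v v' : (forall k, 0 <= u k 0) ->
  (forall k, v k 0 <= v' k 0) -> dot u v <= dot u v'.
Proof. by move=> u0 vw; apply: ler_sum => k _; rewrite ler_wpM2l. Qed.

Lemma dot_pos u : dot (pos u) u = enorm (pos u) ^+ 2.
Proof.
rewrite -dotuu; apply: eq_bigr => k _; rewrite posE /Num.max.
by case: ifPn => // _; rewrite !mul0r.
Qed.

(** Coordinatewise, clipping a negative entry at 0 brings it closer to every nonnegative target. *)
Lemma pos_dist_le u v : (forall k, 0 <= v k 0) ->
  enorm (pos u - v) <= enorm (u - v).
Proof.
move=> v0; rewrite !enormE ler_l2norm// => k; rewrite !mxE.
rewrite /Num.max; case: ifPn => //; rewrite -leNgt => u0.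
have vk := v0 k.
by rewrite sub0r normrN (ger0_norm vk) distrC ger0_norm; lra.
Qed.

End Vectors.

(** Cauchy-Schwarz on each row. The crude constant serves only to bound from above the set whose
    [sup] is [opnorm]. *)
Lemma mulmx_enorm_bound m p (A : 'M[R]_(m, p)) (v : 'cV[R]_p) :
  enorm (A *m v) <=
  l2norm (fun i => enorm (row i A)^T) * enorm v.
Proof.
have -> : l2norm (fun i => enorm (row i A)^T) * enorm v =
   l2norm (fun i => enorm v * enorm (row i A)^T).
  by rewrite l2normZ ger0_norm ?enorm_ge0// mulrC.
rewrite enormE ler_l2norm// => i; rewrite [leRHS]ger0_norm ?mulr_ge0 ?enorm_ge0//.
have -> : (A *m v) i 0 = dot (row i A)^T v.
  by rewrite mxE; apply: eq_bigr => k _; rewrite !mxE.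
rewrite mulrC ler_norml ler_dot andbT lerNl -dotNl.
by rewrite -(enormN (row i A)^T) ler_dot.
Qed.

Lemma ler_opnorm m p (A : 'M[R]_(m, p)) (v : 'cV[R]_p) :
  enorm (A *m v) <= opnorm A * enorm v.
Proof.
have [->|v0] := eqVneq v 0; first by rewrite mulmx0 !enorm0 mulr0.
have v_gt0 : 0 < enorm v by rewrite enorm_gt0.
have -> : v = enorm v *: ((enorm v)^-1 *: v).
  by rewrite scalerA divff ?scale1r ?gt_eqF.
rewrite -scalemxAr !enormZ (ger0_norm (enorm_ge0 _)) ger0_norm ?invr_ge0 ?enorm_ge0//.
rewrite mulVf ?gt_eqF// mulr1 mulrC ler_wpM2r ?enorm_ge0//.
apply: ub_le_sup.
  exists (l2norm (fun i => enorm (row i A)^T)) => _ [u /= u1 <-].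
  by rewrite (le_trans (mulmx_enorm_bound _ _))// ler_piMr// l2norm_ge0.
exists ((enorm v)^-1 *: v) => //=.
by rewrite enormZ ger0_norm ?invr_ge0 ?enorm_ge0// mulVf ?gt_eqF.
Qed.

Lemma dot_trmx_mulmx m p (A : 'M[R]_(m, p)) (u : 'cV[R]_m) (v : 'cV[R]_p) :
  dot (A^T *m u) v = dot u (A *m v).
Proof. by rewrite !dotE trmx_mul trmxK mulmxA. Qed.

End EuclideanNorm.

(** * Contraction of consensus over a connectivity window *)

Section Consensus.
Context {R : realType} {n : nat}.
Implicit Types (A : 'M[R]_n) (u v : 'cV[R]_n) (S : {set 'I_n}).

(** Row sums 1 make each inner sum the variance of the entries averaged by row [i]; column sums 1
    make the weighted squares add up to the squared norm of [u]. *)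
Lemma stochastic_variance A u : doubly_stochastic A ->
  enorm u ^+ 2 - enorm (A *m u) ^+ 2 =
  \sum_i \sum_j A i j * (u j 0 - (A *m u) i 0) ^+ 2.
Proof.
case=> _ rowA colA; rewrite !enormE !l2normE.
have -> : \sum_k u k 0 ^+ 2 = \sum_i \sum_j A i j * u j 0 ^+ 2.
  by rewrite exchange_big /=; apply: eq_bigr => j _; rewrite -mulr_suml colA mul1r.
rewrite -sumrB; apply: eq_bigr => i _; set c := (A *m u) i 0.
have cE : \sum_j A i j * u j 0 = c by rewrite /c mxE.
transitivity (\sum_j A i j * u j 0 ^+ 2 - 2 * c * \sum_j A i j * u j 0
              + c ^+ 2 * \sum_j A i j); first by rewrite cE rowA; ring.
by rewrite !mulr_sumr -sumrB -big_split /=; apply: eq_bigr => j _; ring.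
Qed.

Lemma stochastic_enorm_le A u :
  doubly_stochastic A -> enorm (A *m u) <= enorm u.
Proof.
move=> dsA; rewrite -(@ler_pXn2r _ 2)// ?nnegrE ?enorm_ge0// -subr_ge0.
rewrite stochastic_variance//; case: dsA => A0 _ _.
apply: sumr_ge0 => i _; apply: sumr_ge0 => j _.
by rewrite mulr_ge0 ?sqr_ge0.
Qed.

(** Of the variance formula only the terms [(i, i)] and [(i, j)] are kept; around any centre
    [w (p^2 + r^2) >= w / 2 (p - r)^2]. *)
Lemma stochastic_enorm_drop A u (w : R) i j : doubly_stochastic A -> i != j ->
  0 <= w -> w <= A i i -> w <= A i j ->
  enorm (A *m u) ^+ 2 <= enorm u ^+ 2 - w / 2 * (u i 0 - u j 0) ^+ 2.
Proof.
move=> dsA ij w0 wi wj; rewrite lerBrDr addrC -lerBrDr stochastic_variance//.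
have A0 : forall i j, 0 <= A i j by case: dsA.
have T0 k l : 0 <= A k l * (u l 0 - (A *m u) k 0) ^+ 2.
  by rewrite mulr_ge0 ?sqr_ge0.
rewrite (bigD1 i)//= (bigD1 i)//= (bigD1 j) 1?eq_sym//=.
set c := (A *m u) i 0.
have H1 : w * (u i 0 - c) ^+ 2 <= A i i * (u i 0 - c) ^+ 2.
  by rewrite ler_wpM2r ?sqr_ge0.
have H2 : w * (u j 0 - c) ^+ 2 <= A i j * (u j 0 - c) ^+ 2.
  by rewrite ler_wpM2r ?sqr_ge0.
set r1 := \sum_(_ < _ | _) _; set r2 := \sum_(_ < _ | _) _.
have r1_ge0 : 0 <= r1 by apply: sumr_ge0.
have r2_ge0 : 0 <= r2 by apply: sumr_ge0 => k _; apply: sumr_ge0.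
have H3 : 0 <= w / 2 * ((u i 0 - c) + (u j 0 - c)) ^+ 2.
  by rewrite mulr_ge0 ?sqr_ge0// divr_ge0.
have -> : w / 2 * (u i 0 - u j 0) ^+ 2 =
  w * (u i 0 - c) ^+ 2 + w * (u j 0 - c) ^+ 2
  - w / 2 * ((u i 0 - c) + (u j 0 - c)) ^+ 2 by field.
lra.
Qed.

Fixpoint transition (W : nat -> 'M[R]_n) (s l : nat) : 'M[R]_n :=
  if l is l'.+1 then W (s + l')%N *m transition W s l' else 1%:M.

Lemma transition_enorm_le W s l v :
  (forall k, (k < l)%N -> doubly_stochastic (W (s + k)%N)) ->
  enorm (transition W s l *m v) <= enorm v.
Proof.
elim: l => [|l IHl] dsW /=; first by rewrite mul1mx.
rewrite -mulmxA (le_trans (stochastic_enorm_le _ (dsW _ (ltnSn l))))//.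
by apply: IHl => k kl; apply: dsW; rewrite ltnS ltnW.
Qed.

(* As long as no weight crosses the cut (S, ~: S), averaging keeps the values
   on S above a and those outside below b. *)
Lemma transition_separated W s l v S (a b : R) :
  (forall k, (k < l)%N -> doubly_stochastic (W (s + k)%N)) ->
  (forall k i j, (k < l)%N -> (i \in S) != (j \in S) -> W (s + k)%N i j = 0) ->
  (forall i, i \in S -> a <= v i 0) -> (forall i, i \notin S -> v i 0 <= b) ->
  (forall i, i \in S -> a <= (transition W s l *m v) i 0) /\
  (forall i, i \notin S -> (transition W s l *m v) i 0 <= b).
Proof.
elim: l => [|l IHl] dsW noX Sa Sb /=; first by rewrite mul1mx.
have [] := IHl _ _ Sa Sb.
- by move=> k kl; apply: dsW; rewrite ltnS ltnW.
- by move=> k i j kl; apply: noX; rewrite ltnS ltnW.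
move=> {}Sa {}Sb; rewrite -mulmxA; set u := transition W s l *m v in Sa Sb *.
have [W0 rowW _] := dsW _ (ltnSn l).
split=> i iS; rewrite mxE.
  rewrite -[a]mul1r -(rowW i) mulr_suml ler_sum// => j _.
  have [jS|jS] := boolP (j \in S); first by rewrite ler_wpM2l ?Sa.
  by rewrite noX ?mul0r// iS (negbTE jS).
rewrite -[b]mul1r -(rowW i) mulr_suml ler_sum// => j _.
have [jS|jS] := boolP (j \in S); last by rewrite ler_wpM2l ?Sb.
by rewrite noX ?mul0r// jS (negbTE iS).
Qed.

(** Up to the first round [k] with a weight across the cut, the two sides stay separated by
    [b <= a]. Round [k] therefore averages two values at distance at least [a - b], and no other
    round increases the norm. *)
Lemma window_enorm_drop W s l v S (a b w : R) :
  0 <= w -> b <= a ->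
  (forall k, (k < l)%N -> doubly_stochastic (W (s + k)%N)) ->
  (forall k i j, (k < l)%N ->
     (i == j) || (0 < W (s + k)%N i j) -> w <= W (s + k)%N i j) ->
  (forall i, i \in S -> a <= v i 0) -> (forall i, i \notin S -> v i 0 <= b) ->
  (exists k i j, [/\ (k < l)%N, (i \in S) != (j \in S) & 0 < W (s + k)%N i j]) ->
  enorm (transition W s l *m v) ^+ 2 <= enorm v ^+ 2 - w / 2 * (a - b) ^+ 2.
Proof.
move=> w0 ba dsW wW Sa Sb [k0 [i0 [j0 [k0l S0 W0]]]].
pose Q k := (k < l)%N &&
  [exists i, exists j, ((i \in S) != (j \in S)) && (0 < W (s + k)%N i j)].
have exQ : exists k, Q k.
  exists k0; rewrite /Q k0l; apply/existsP; exists i0.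
  by apply/existsP; exists j0; rewrite S0.
case: (ex_minnP exQ) => k /andP[kl /existsP[i /existsP[j /andP[ijS Wij]]]] kmin.
have dsWk : forall k', (k' < k)%N -> doubly_stochastic (W (s + k')%N).
  by move=> k' k'k; apply: dsW; exact: ltn_trans kl.
have [] := transition_separated dsWk _ Sa Sb.
  move=> k' i' j' k'k ij'; have [Wge0 _ _] := dsWk _ k'k.
  apply/eqP; rewrite eq_le Wge0 andbT leNgt; apply/negP => W'.
  have : Q k'.
    rewrite /Q (ltn_trans k'k kl); apply/existsP; exists i'.
    by apply/existsP; exists j'; rewrite ij'.
  by move/kmin; rewrite leqNgt k'k.
set u := transition W s k *m v => uSa uSb.
have mono l' : (k.+1 <= l' <= l)%N ->
    enorm (transition W s l' *m v) <= enorm (transition W s k.+1 *m v).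
  elim: l' => [//|l' IH] /andP[]; rewrite leq_eqVlt => /predU1P[[->]//|kl' l'l].
  rewrite (le_trans _ (IH _))//; last by rewrite -ltnS kl' ltnW.
  by rewrite /= -mulmxA stochastic_enorm_le//; exact: dsW.
have sq : enorm (transition W s l *m v) ^+ 2 <= enorm (W (s + k)%N *m u) ^+ 2.
  rewrite lerXn2r ?nnegrE ?enorm_ge0// (le_trans (mono l _)) ?kl ?leqnn//.
  by rewrite /= -mulmxA.
apply: (le_trans sq).
have ij : i != j by apply: contraNneq ijS => ->.
have := stochastic_enorm_drop u (dsW _ kl) ij w0.
move=> /(_ (wW _ _ _ kl _) (wW _ _ _ kl _)).
rewrite eqxx Wij orbT => /(_ isT isT) /le_trans; apply.
have uv : enorm u ^+ 2 <= enorm v ^+ 2.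
  by rewrite lerXn2r ?nnegrE ?enorm_ge0// transition_enorm_le.
have ab : w / 2 * (a - b) ^+ 2 <= w / 2 * (u i 0 - u j 0) ^+ 2.
  rewrite ler_wpM2l ?divr_ge0//.
  rewrite -(real_normK (num_real (u i 0 - u j 0))) lerXn2r ?nnegrE ?subr_ge0//.
  move: ijS; have [iS|iS] := boolP (i \in S); have [jS|jS] := boolP (j \in S) => // _.
    by rewrite (le_trans _ (ler_norm _))// lerB ?uSa ?uSb.
  by rewrite distrC (le_trans _ (ler_norm _))// lerB ?uSa ?uSb.
lra.
Qed.

(* The n thresholds lo + k (hi - lo) / n cut out nested proper nonempty sets, so
   two consecutive ones coincide. *)
Lemma exists_gap (v : 'I_n -> R) (i0 i1 : 'I_n) : v i0 < v i1 ->
  exists S, exists a b,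
    [/\ a - b = (v i1 - v i0) / n%:R, i1 \in S, i0 \notin S,
        forall i, i \in S -> a <= v i & forall i, i \notin S -> v i <= b].
Proof.
move=> v01.
have n_gt0 : 0 < n%:R :> R by rewrite ltr0n (leq_ltn_trans _ (ltn_ord i0)).
pose h := (v i1 - v i0) / n%:R; pose th k := v i0 + k%:R * h.
have h_gt0 : 0 < h by rewrite divr_gt0 ?subr_gt0.
pose S k := [set i | th k < v i]%SET.
have S_i1 k : (k < n)%N -> i1 \in S k.
  move=> kn; rewrite inE /th -ltrBrDl /h mulrA ltr_pdivrMr// mulrC.
  by rewrite ltr_pM2l ?subr_gt0// ltr_nat.
have S_i0 k : i0 \notin S k.
  by rewrite inE -leNgt /th lerDl mulr_ge0// ltW.
have SS k : S k.+1 \subset S k.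
  apply/fintype.subsetP => i; rewrite !inE; apply: le_lt_trans.
  by rewrite /th lerD2l ler_wpM2r ?ler_nat// ltW.
have [k [kn Sk]] : exists k, (k.+1 < n)%N /\ S k.+1 = S k.
  apply: contrapT => /forallNP noS.
  have card k : (k < n)%N -> (#|S k| + k < n)%N.
    elim: k => [_|k IH kn].
      rewrite addn0 -[ltnRHS](card_ord n) -cardsT (cardsD1 i0 [set: 'I_n]%SET).
      rewrite finset.in_setT ltnS; apply/subset_leq_card/fintype.subsetP => i iS.
      by rewrite !inE andbT; apply: contraTneq iS => ->.
    have /proper_card lt : S k.+1 \proper S k.
      by rewrite finset.properEneq SS andbT; apply/eqP => Sk; apply: (noS k).
    by rewrite addnS (leq_ltn_trans _ (IH (ltnW kn)))// -addSn leq_add2r.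
  have n0 : (0 < n)%N by rewrite (leq_ltn_trans _ (ltn_ord i0)).
  have := card n.-1; rewrite ltn_predL n0 => /(_ isT).
  have : (0 < #|S n.-1|)%N.
    by rewrite (cardsD1 i1) S_i1 ?ltn_predL.
  by lia.
(* Values in [S k.+1] exceed [th k.+1]; as this set equals [S k], all other values are at most
   [th k], so none lies in between. *)
exists (S k.+1), (th k.+1), (th k); split.
- by rewrite /th -/h -natr1; ring.
- exact: S_i1.
- exact: S_i0.
- by move=> i; rewrite inE => /ltW.
- by move=> i; rewrite Sk inE -leNgt.
Qed.

(** Popoviciu's variance inequality, from the nonnegativity of [(v i - lo) * (hi - v i)]. *)
Lemma mean_zero_enorm_le v (lo hi : R) : \sum_i v i 0 = 0 ->
  (forall i, lo <= v i 0 <= hi) -> enorm v ^+ 2 <= n%:R * (hi - lo) ^+ 2 / 4.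
Proof.
move=> v0 lohi; rewrite enormE l2normE.
have : 0 <= \sum_i (v i 0 - lo) * (hi - v i 0).
  apply: sumr_ge0 => i _; have /andP[vlo vhi] := lohi i.
  by rewrite mulr_ge0// subr_ge0.
have -> : \sum_i (v i 0 - lo) * (hi - v i 0) =
    (hi + lo) * (\sum_i v i 0) - \sum_i v i 0 ^+ 2 - \sum_(i < n) (lo * hi).
  by rewrite mulr_sumr -!sumrB; apply: eq_bigr => i _; ring.
rewrite v0 sumr_const card_ord -[lo * hi *+ n]mulr_natl mulr0 => H.
have : 0 <= n%:R * (hi + lo) ^+ 2 / 4 :> R by rewrite divr_ge0// mulr_ge0// sqr_ge0.
have -> : n%:R * (hi - lo) ^+ 2 / 4 = n%:R * (hi + lo) ^+ 2 / 4 - n%:R * (lo * hi) by field.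
lra.
Qed.

(** With [r] the range of [v], the cut at a gap [r / n] lowers the squared norm by
    [w / 2 * (r / n)^2], while mean zero gives [r^2 >= 4 |v|^2 / n]; the product is
    [2 w |v|^2 / n^3]. *)
Lemma window_contraction W s l v (w : R) : 0 <= w ->
  (forall k, (k < l)%N -> doubly_stochastic (W (s + k)%N)) ->
  (forall k i j, (k < l)%N ->
     (i == j) || (0 < W (s + k)%N i j) -> w <= W (s + k)%N i j) ->
  (forall S i j, i \in S -> j \notin S ->
   exists k i' j',
     [/\ (k < l)%N, (i' \in S) != (j' \in S) & 0 < W (s + k)%N i' j']) ->
  \sum_i v i 0 = 0 ->
  enorm (transition W s l *m v) ^+ 2
    <= (1 - 2 * w / n%:R ^+ 3) * enorm v ^+ 2.
Proof.
move=> w0 dsW wW cross v0.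
have [n0|n_gt0] := posnP n.
  have -> : transition W s l *m v = 0.
    by apply/matrixP => i; case: i (ltn_ord i) => i /= ? ; lia.
  have -> : v = 0 by apply/matrixP => i; case: i (ltn_ord i) => i /= ? ; lia.
  by rewrite enorm0 expr0n mulr0.
pose i0 := [arg min_(i < Ordinal n_gt0) v i 0]%O.
pose i1 := [arg max_(i > Ordinal n_gt0) v i 0]%O.
have lo i : v i0 0 <= v i 0 by rewrite /i0; case: arg_minP => // k _; apply.
have hi i : v i 0 <= v i1 0 by rewrite /i1; case: arg_maxP => // k _; apply.
have /mean_zero_enorm_le vle := v0.
have {}vle := vle (v i0 0) (v i1 0).
have {vle} /vle vle : forall i, v i0 0 <= v i 0 <= v i1 0 by move=> i; rewrite lo hi.
have N0 : n%:R != 0 :> R by rewrite pnatr_eq0 -lt0n.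
have [le10|lt01] := leP (v i1 0) (v i0 0).
  have vle0 : enorm v ^+ 2 <= 0.
    rewrite (le_trans vle)// (_ : v i1 0 = v i0 0) ?subrr ?expr0n ?mulr0 ?mul0r//.
    by apply/eqP; rewrite eq_le le10 lo.
  have v_eq0 : enorm v ^+ 2 = 0 by apply/eqP; rewrite eq_le vle0 sqr_ge0.
  rewrite v_eq0 mulr0 -v_eq0 lerXn2r ?nnegrE ?enorm_ge0//.
  exact: transition_enorm_le.
have [S [a [b [ab Si1 Si0 Sa Sb]]]] := @exists_gap (fun i => v i 0) _ _ lt01.
have ba : b <= a.
  by rewrite -subr_ge0 ab divr_ge0// subr_ge0 ltW.
have := window_enorm_drop w0 ba dsW wW Sa Sb (cross _ _ _ Si1 Si0).
move/le_trans; apply; rewrite ab [leRHS]mulrBl mul1r lerD2l lerN2.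
have w' : 0 <= 2 * w / n%:R ^+ 3 by rewrite divr_ge0 ?mulr_ge0 ?exprn_ge0.
apply: le_trans (ler_wpM2l w' vle) _.
by rewrite le_eqVlt; apply/orP; left; apply/eqP; field.
Qed.

End Consensus.

(** * Cumulative disagreement of the dual variables *)

Section DelayedSum.
Context {R : realType}.

(** Truncated subtraction sends the first indices to 0, where [f] vanishes, so a delay only loses
    terms at the end. *)
Lemma ler_sum_shift (f : nat -> R) (N k : nat) : f 0%N = 0 ->
  (forall t, 0 <= f t) ->
  \sum_(0 <= t < N) f (t - k)%N <= \sum_(0 <= t < N) f t.
Proof.
move=> f0 f_ge0; elim: k => [|k IHk].
  by under eq_bigr do rewrite subn0.
apply: le_trans IHk; case: N => [|N]; first by rewrite !big_geq.
rewrite big_nat_recl// sub0n f0 add0r big_nat_recr//=.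
by under eq_bigr do rewrite subSS; rewrite lerDl.
Qed.

(** The recursion is summed over [t]; each delayed sum is at most the undelayed one, and [rho] times
    the sum of [e] moves to the left. Round 0 enters through [e 0 = 0]. *)
Lemma ler_sum_delayed (e eps : nat -> R) (rho : R) (l T : nat) :
  0 <= rho -> e 0%N = 0 -> eps 0%N = 0 ->
  (forall t, 0 <= e t) -> (forall t, 0 <= eps t) ->
  (forall t, (0 < t)%N -> e t <= rho * e (t - l)%N + \sum_(k < l) eps (t - k)%N) ->
  (1 - rho) * \sum_(1 <= t < T.+1) e t <= l%:R * \sum_(1 <= t < T.+1) eps t.
Proof.
move=> rho0 e0 eps0 e_ge0 eps_ge0 rec.
have from0 (f : nat -> R) : f 0%N = 0 ->
    \sum_(1 <= t < T.+1) f t = \sum_(0 <= t < T.+1) f t.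
  by move=> f0; rewrite [RHS]big_ltn// f0 add0r.
rewrite !from0// mulrBl mul1r lerBlDl.
apply: (@le_trans _ _ (\sum_(0 <= t < T.+1)
   (rho * e (t - l)%N + \sum_(k < l) eps (t - k)%N))).
  apply: ler_sum => -[_|t _]; last exact: rec.
  by rewrite e0 addr_ge0 ?mulr_ge0 ?sumr_ge0.
rewrite big_split /= lerD//.
  by rewrite -mulr_sumr ler_wpM2l// ler_sum_shift.
rewrite exchange_big /=.
apply: (@le_trans _ _ (\sum_(k < l) \sum_(0 <= t < T.+1) eps t)).
  by apply: ler_sum => k _; exact: ler_sum_shift.
by rewrite sumr_const card_ord mulr_natl.
Qed.

End DelayedSum.

Section Disagreement.
Context {R : realType} {n m : nat}.
Implicit Types (A B : 'M[R]_(n, m)) (M : 'M[R]_n).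

(** The Frobenius norm. Row [i] will hold the dual variable of agent [i]: network averaging acts on
    columns, pairing with constraints on rows. *)
Definition frob A : R := l2norm (fun ij : 'I_n * 'I_m => A ij.1 ij.2).

Lemma frob_ge0 A : 0 <= frob A.
Proof. exact: l2norm_ge0. Qed.

Lemma frob0 : frob 0 = 0.
Proof.
by rewrite /frob /l2norm big1 ?sqrtr0// => i _; rewrite mxE expr0n.
Qed.

Lemma frobD A B : frob (A + B) <= frob A + frob B.
Proof.
rewrite (le_trans _ (l2normD _ _))//.
by rewrite ler_l2norm// => ij; rewrite mxE.
Qed.

Lemma frob_col A : frob A ^+ 2 = \sum_k enorm (col k A) ^+ 2.
Proof.
rewrite l2normE -(pair_bigA _ (fun i j => A i j ^+ 2)) /= exchange_big /=.
apply: eq_bigr => k _; rewrite enormE l2normE.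
by apply: eq_bigr => i _; rewrite mxE.
Qed.

Lemma frob_row A : frob A ^+ 2 = \sum_i enorm (row i A)^T ^+ 2.
Proof.
rewrite l2normE -(pair_bigA _ (fun i j => A i j ^+ 2)) /=.
apply: eq_bigr => i _; rewrite enormE l2normE.
by apply: eq_bigr => k _; rewrite !mxE.
Qed.

Lemma col_mulmx k M A : col k (M *m A) = M *m col k A.
Proof. by rewrite !colE mulmxA. Qed.

Lemma ler_frob_col A B (c : R) : 0 <= c ->
  (forall k, enorm (col k A) ^+ 2 <= c ^+ 2 * enorm (col k B) ^+ 2) ->
  frob A <= c * frob B.
Proof.
move=> c0 AB; rewrite -(@ler_pXn2r _ 2)// ?nnegrE ?mulr_ge0 ?frob_ge0//.
by rewrite exprMn !frob_col mulr_sumr ler_sum.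
Qed.

Lemma stochastic_frob_le M A :
  doubly_stochastic M -> frob (M *m A) <= frob A.
Proof.
move=> dsM; rewrite -[leRHS]mul1r ler_frob_col// => k.
rewrite expr1n mul1r lerXn2r ?nnegrE ?enorm_ge0//.
by rewrite col_mulmx stochastic_enorm_le.
Qed.

(** One Cauchy-Schwarz over all entries costs only the factor [sqrt n]; doing it row by row would
    not control the sum by [frob A] directly. *)
Lemma dot_rows_le A B (c : R) : 0 <= c ->
  (forall i, enorm (row i B)^T <= c) ->
  \sum_i dot (row i A)^T (row i B)^T <= Num.sqrt n%:R * c * frob A.
Proof.
move=> c0 Bc.
have -> : \sum_i dot (row i A)^T (row i B)^T =
    \sum_(ij : 'I_n * 'I_m) A ij.1 ij.2 * B ij.1 ij.2.
  rewrite -(pair_bigA _ (fun i j => A i j * B i j)) /=; apply: eq_bigr => i _.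
  by apply: eq_bigr => k _; rewrite !mxE.
apply: (@le_trans _ _ (frob A * frob B)); first exact: cauchy_schwarz_l2.
rewrite mulrC ler_wpM2r ?frob_ge0//.
rewrite -(@ler_pXn2r _ 2)// ?nnegrE ?mulr_ge0 ?frob_ge0//.
rewrite exprMn (sqr_sqrtr (ler0n R n)) frob_row.
apply: (@le_trans _ _ (\sum_(i < n) c ^+ 2)).
  by apply: ler_sum => i _; rewrite lerXn2r ?nnegrE ?enorm_ge0.
by rewrite sumr_const card_ord mulr_natl.
Qed.

Definition row_mean A : 'rV[R]_m := n%:R^-1 *: \sum_i row i A.

(** The disagreement: the deviation of each row from the network average. Its columns have sum zero,
    as the window contraction requires. *)
Definition centered A : 'M[R]_(n, m) := \matrix_(i, k) (A i k - row_mean A 0 k).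

Lemma row_meanE A k : row_mean A 0 k = n%:R^-1 * \sum_i A i k.
Proof. by rewrite !mxE summxE; under eq_bigr do rewrite mxE. Qed.

Lemma centeredE A i k : centered A i k = A i k - row_mean A 0 k.
Proof. by rewrite mxE. Qed.

Lemma sum_col_centered A k : \sum_i (col k (centered A)) i 0 = 0.
Proof.
have [n0|n_gt0] := posnP n.
  by rewrite big1// => i; case: i (ltn_ord i) => i /= ?; lia.
under eq_bigr do rewrite mxE centeredE.
rewrite sumrB sumr_const card_ord -[_ *+ n]mulr_natl row_meanE mulrA.
by rewrite mulfV ?mul1r ?subrr// pnatr_eq0 -lt0n.
Qed.

Lemma centered0 : centered 0 = 0.
Proof.
apply/matrixP => i k; rewrite centeredE row_meanE big1 => [|j _]; rewrite !mxE//.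
by rewrite mulr0 subrr.
Qed.

Lemma centeredB A B : centered (A - B) = centered A - centered B.
Proof.
apply/matrixP => i k; rewrite [RHS]mxE [X in _ = _ + X]mxE !centeredE !row_meanE.
have -> : \sum_j (A - B) j k = \sum_j A j k - \sum_j B j k.
  by rewrite -sumrB; apply: eq_bigr => j _; rewrite !mxE.
by rewrite !mxE; ring.
Qed.

(** Column sums 1 preserve the mean of each column, and row sums 1 fix matrices with equal rows. *)
Lemma centered_mul M A : doubly_stochastic M ->
  centered (M *m A) = M *m centered A.
Proof.
case=> _ rowM colM; apply/matrixP => i k.
rewrite centeredE [RHS]mxE [(M *m A) i k]mxE.
under [RHS]eq_bigr do rewrite centeredE mulrBr.
rewrite sumrB; congr (_ - _); rewrite -mulr_suml rowM mul1r !row_meanE.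
congr (_ * _); under eq_bigr do rewrite mxE.
by rewrite exchange_big /=; apply: eq_bigr => j _; rewrite -mulr_suml colM mul1r.
Qed.

(** Pythagoras in each column: the cross term vanishes because centered columns have sum zero. *)
Lemma centered_frob_le A : frob (centered A) <= frob A.
Proof.
rewrite -[leRHS]mul1r ler_frob_col// => k; rewrite expr1n mul1r.
have s0 := sum_col_centered A k.
have -> : enorm (col k A) ^+ 2 = enorm (col k (centered A)) ^+ 2 +
    \sum_(i < n) row_mean A 0 k ^+ 2
    + 2 * row_mean A 0 k * \sum_i (col k (centered A)) i 0.
  rewrite !enormE !l2normE mulr_sumr -!big_split /=; apply: eq_bigr => i _.
  by rewrite ![col _ _ _ _]mxE centeredE; ring.
by rewrite s0 mulr0 addr0 lerDl sumr_ge0// => i _; exact: sqr_ge0.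
Qed.

Variables (W : nat -> 'M[R]_n) (Q : nat -> 'M[R]_(n, m)) (eps : nat -> R).
Hypothesis dsW : forall t, (0 < t)%N -> doubly_stochastic (W t).
Hypothesis Qeps : forall t, (0 < t)%N -> frob (Q t.+1 - W t *m Q t) <= eps t.+1.

(** Variation of constants: each perturbation is carried to the end of the window by doubly
    stochastic matrices, which do not enlarge it. *)
Lemma perturbed_transition s l : (0 < s)%N ->
  frob (centered (Q (s + l)%N) - transition W s l *m centered (Q s))
    <= \sum_(k < l) eps (s + l - k)%N.
Proof.
move=> s0; elim: l => [|l IHl]; first by rewrite big_ord0 addn0 mul1mx subrr frob0.
have sl0 : (0 < s + l)%N by rewrite ltn_addr.
rewrite big_ord_recl addnS subn0 /= -mulmxA.
set M := transition W s l *m _ in IHl *.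
have -> : centered (Q (s + l).+1) - W (s + l)%N *m M =
    centered (Q (s + l).+1 - W (s + l)%N *m Q (s + l)%N)
    + W (s + l)%N *m (centered (Q (s + l)%N) - M).
  by rewrite centeredB centered_mul; [rewrite mulmxBr addrA subrK | exact: dsW].
rewrite (le_trans (frobD _ _))// lerD//.
  by rewrite (le_trans (centered_frob_le _))// Qeps.
by rewrite (le_trans (stochastic_frob_le _ (dsW sl0))).
Qed.

Lemma sum_disagreement_le (rho : R) (l T : nat) :
  0 <= rho -> (0 < l)%N -> Q 0%N = 0 -> Q 1%N = 0 -> eps 0%N = 0 ->
  (forall t, 0 <= eps t) ->
  (forall s (v : 'cV[R]_n), (0 < s)%N -> \sum_i v i 0 = 0 ->
     enorm (transition W s l *m v) ^+ 2 <= rho ^+ 2 * enorm v ^+ 2) ->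
  (1 - rho) * \sum_(1 <= t < T.+1) frob (centered (Q t))
    <= l%:R * \sum_(1 <= t < T.+1) eps t.
Proof.
move=> rho0 l0 Q0 Q1 eps0 eps_ge0 contr.
apply: ler_sum_delayed => // [|t|t t0]; rewrite ?Q0 ?centered0 ?frob0 ?frob_ge0//.
have [lt_lt|le_tl] := ltnP l t.
  have s0 : (0 < t - l)%N by rewrite subn_gt0.
  have := perturbed_transition l s0; rewrite subnK 1?ltnW// => H.
  rewrite -[X in frob X](subrK (transition W (t - l) l *m centered (Q (t - l)%N))).
  rewrite addrC (le_trans (frobD _ _))// lerD//.
  rewrite ler_frob_col// => k; rewrite col_mulmx contr//.
  exact: sum_col_centered.
(* For [t <= l] a full window would start before round 1. The recursion is unrolled from round 1
   instead, where [Q] vanishes, and the delayed term [t - l = 0] contributes nothing. *)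
have := perturbed_transition t.-1 (ltnSn 0); rewrite add1n prednK// Q1.
rewrite centered0 mulmx0 subr0 => /le_trans; apply.
have -> : (t - l = 0)%N by apply/eqP; rewrite subn_eq0.
rewrite Q0 centered0 frob0 mulr0 add0r.
have tl : (t.-1 <= l)%N by rewrite (leq_trans (leq_pred _)).
rewrite (big_ord_widen _ (fun k => eps (t - k)%N) tl) big_mkcond ler_sum// => k _.
by case: ifP.
Qed.

End Disagreement.

(** * Power sums and the mixing constants *)

Section Powers.
Context {R : realType}.
Implicit Types (p x y k : R).

(** Bernoulli's inequality for exponents at most 1: convexity of the exponential between [ln x] and
    0, with weights [p] and [1 - p]. *)
Lemma powR_tangent_le p x : 0 < p -> p <= 1 -> 0 <= x ->
  x `^ p <= 1 + p * (x - 1).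
Proof.
move=> p0 p1; rewrite le_eqVlt => /predU1P[<-|x0].
  by rewrite powR0 ?gt_eqF//; lra.
have := convex_expR (Itv01 (ltW p0) p1) (ln x) 0.
rewrite !convRE /= expR0 lnK ?posrE// mulr0 addr0 /powR gt_eqF//.
by rewrite /unstable.onem => /le_trans; apply; lra.
Qed.

Lemma powR1B k x : 0 < x -> x `^ (1 - k) = x * (1 / x `^ k).
Proof.
move=> x0; rewrite div1r -powRN -{2}(powRr1 (ltW x0)) -powRD//.
by rewrite (gt_eqF x0) implybT.
Qed.

Lemma ler_inv_powR k x y : 0 <= k -> 0 < x -> x <= y ->
  1 / y `^ k <= 1 / x `^ k.
Proof.
move=> k0 x0 xy; have y0 := lt_le_trans x0 xy.
rewrite !div1r lef_pV2 ?posrE ?powR_gt0//.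
by apply: ge0_ler_powR; rewrite // nnegrE ltW.
Qed.

(** The tangent bound at [T / (T + 1)], scaled by [(T + 1)^p], is the induction step
    [p / (T + 1)^(1 - p) <= (T + 1)^p - T^p]; the step from [T = 0] uses that bound at 0. *)
Lemma sum_powR_le p (T : nat) : 0 < p -> p <= 1 ->
  \sum_(1 <= t < T.+1) 1 / t%:R `^ (1 - p) <= T%:R `^ p / p.
Proof.
move=> p0 p1; rewrite ler_pdivlMr// mulr_suml.
elim: T => [|T IH]; first by rewrite big_geq// powR_ge0.
rewrite big_nat_recr//=.
suff : 1 / T.+1%:R `^ (1 - p) * p <= T.+1%:R `^ p - T%:R `^ p by lra.
have T1 : 0 < T.+1%:R :> R by rewrite ltr0n.
have := powR_tangent_le p0 p1 (divr_ge0 (ler0n R T) (ltW T1)).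
move=> /(ler_wpM2l (powR_ge0 T.+1%:R p)).
rewrite -powRM ?divr_ge0// mulrC divfK ?gt_eqF//.
have -> : T.+1%:R `^ p = T.+1%:R * (1 / T.+1%:R `^ (1 - p)).
  by rewrite -powR1B// subKr.
set a := 1 / _; set N : R := T.+1%:R in T1 *.
have -> : T%:R = N - 1 by rewrite /N -natr1 addrK.
have -> : N * a * (1 + p * ((N - 1) / N - 1)) = N * a - a * p.
  by field; rewrite gt_eqF.
lra.
Qed.

(** For [k = kappa]: the regularization [beta] absorbs the growth of [1 / gamma], which lets the
    dual distances telescope. The left side equals [t / (t + 1)^k]. *)
Lemma powR_succ_decay_le k (t : nat) : 0 <= k -> (0 < t)%N ->
  t.+1%:R `^ (1 - k) - 1 / t.+1%:R `^ k <= t%:R `^ (1 - k).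
Proof.
move=> k0 t0; have tR : 0 < t%:R :> R by rewrite ltr0n.
rewrite !powR1B//.
have -> : t.+1%:R * (1 / t.+1%:R `^ k) - 1 / t.+1%:R `^ k
    = t%:R * (1 / t.+1%:R `^ k) by rewrite -{1}natr1; ring.
by rewrite ler_wpM2l// ler_inv_powR// ler_nat.
Qed.

(** Bounds the growth of [1 / alpha] when [c = 1 - kappa]; it decays, so strong convexity eventually
    dominates it. *)
Lemma powR_succ_diff_le k (t : nat) : 0 <= k -> (0 < t)%N ->
  t.+1%:R `^ (1 - k) - t%:R `^ (1 - k) <= 1 / t%:R `^ k.
Proof.
move=> k0 t0; have tR : 0 < t%:R :> R by rewrite ltr0n.
rewrite !powR1B// -natr1.
have := @ler_inv_powR k t%:R (t%:R + 1) k0 tR _.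
rewrite lerDl ler01 => /(_ isT) H.
have : (t%:R + 1) * (1 / (t%:R + 1) `^ k) <= (t%:R + 1) * (1 / t%:R `^ k).
  by rewrite ler_wpM2l// addr_ge0.
lra.
Qed.

Lemma mul_inv_powR k x : 0 < x -> 1 / x `^ (1 - k) * (1 / x `^ k) = x^-1.
Proof.
move=> x0; rewrite !div1r -invfM -powRD ?subrK ?powRr1 ?ltW//.
by rewrite (gt_eqF x0) implybT.
Qed.

(* With z = 1 - w / (2 n^2) = lambda ^ iota, factoring 1 - lambda ^ iota gives
   1 - z >= (1 - lambda) * iota * z. *)
Lemma tau_lambda_ge (w : R) (n l : nat) : 0 < w < 1 -> (0 < n)%N -> (0 < l)%N ->
  let z : R := 1 - w / (2 * n%:R ^+ 2) in
  let lambda := z `^ (1 / l%:R) in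
  lambda < 1 /\ 2 * n%:R ^+ 2 * l%:R / w <= (z ^+ 2)^-1 / (1 - lambda).
Proof.
move=> /andP[w0 w1] n0 l0 z lambda.
have n1 : 1 <= n%:R :> R by rewrite ler1n.
have n2 : 1 <= n%:R ^+ 2 :> R by rewrite exprn_ege1.
set D := 2 * n%:R ^+ 2; have D1 : 1 < D by rewrite /D; lra.
have D0 : 0 < D by exact: lt_trans D1.
have wD0 : 0 < w / D by rewrite divr_gt0.
have wD1 : w / D < 1 by rewrite ltr_pdivrMr// mul1r (lt_trans w1).
have z0 : 0 < z by rewrite /z -/D; lra.
have z1 : z < 1 by rewrite /z -/D; lra.
have lR : 0 < l%:R :> R by rewrite ltr0n.
have lam0 : 0 < lambda by rewrite powR_gt0.
have lamz : lambda ^+ l = z.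
  rewrite -powR_mulrn ?ltW// /lambda -powRrM div1r mulVf ?gt_eqF//.
  by rewrite powRr1// ltW.
have lam1 : lambda < 1.
  rewrite ltNge; apply/negP => /(exprn_ege1 l); rewrite lamz; lra.
split=> //.
have : (1 - lambda) * (l%:R * z) <= w / D.
  have -> : w / D = 1 - lambda ^+ l by rewrite lamz /z -/D; ring.
  rewrite -[in leRHS](expr1n _ l) subrXX; apply: ler_wpM2l; first by rewrite subr_ge0 ltW.
  have -> : l%:R * z = \sum_(i < l) z by rewrite sumr_const card_ord mulr_natl.
apply: ler_sum => i _; rewrite expr1n mul1r -lamz.
  apply: ler_wiXn2l; [exact: ltW | exact: ltW | exact/ltnW/ltn_ord].
rewrite ler_pdivlMr// => H; rewrite ler_pdivlMr ?subr_gt0//.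
(* One factor [1 / z] of [tau] cancels the [z] in the bound above; the other is at least 1 and is
   dropped. *)
rewrite (_ : (z ^+ 2)^-1 = z^-1 * z^-1); last by rewrite expr2 invfM.
have -> : D * l%:R / w * (1 - lambda) = z^-1 * ((1 - lambda) * (l%:R * z) * D / w).
  by field; rewrite !gt_eqF.
apply: ler_wpM2l; first by rewrite invr_ge0 ltW.
rewrite ler_pdivrMr// (le_trans H)// -[leLHS]mul1r; apply: ler_wpM2r; first exact: ltW.
by rewrite invf_ge1// ltW.
Qed.

End Powers.

(** * Optimality of the mirror step *)

Section MirrorStep.
Context {R : realType} {p : nat}.
Implicit Types (A : set 'cV[R]_p) (x y z v g : 'cV[R]_p).

(** The radius is measured in the sup norm, which carries the topology, and the error in the
    Euclidean norm. *)
Lemma is_gradient_near A (h : 'cV[R]_p -> R) y v (eps : R) :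
  is_gradient A h y v -> 0 < eps ->
  exists2 del : R, 0 < del & forall x, A x -> x != y -> `|x - y| < del ->
    `|h x - h y - dot v (x - y)| <= eps * enorm (x - y).
Proof.
move=> /cvgr0_norm_lt hy eps0; have := hy _ eps0.
rewrite !near_withinE; move/nbhs_ballP => [del /= del0 hdel].
exists del => // x Ax xy xdel.
have : `|(h x - h y - dot v (x - y)) / enorm (x - y)| < eps.
  apply: hdel => //=; rewrite -ball_normE /=.
  by rewrite distrC.
have xy0 : 0 < enorm (x - y) by rewrite enorm_gt0 subr_eq0.
rewrite normrM normfV (ger0_norm (enorm_ge0 _)).
by rewrite ltr_pdivrMr// => /ltW.
Qed.


(** First-order optimality by a direct argument: were the expression [S] negative, a small step [th]
    from [z] towards [y] would change the objective by at most [th * S / 2 < 0]. *)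
Lemma argmin_variational A (r psi : 'cV[R]_p -> R) (al : R) a g gz y z :
  convex_set A -> convex_function A r -> 0 <= al -> is_gradient A psi z gz ->
  is_argmin A (fun u => al * dot u a + al * r u + (psi u - dot g u)) z ->
  A y ->
  0 <= al * dot (y - z) a + al * (r y - r z) + dot (gz - g) (y - z).
Proof.
move=> cA cr al0 dpsi [Az zmin] Ay; rewrite leNgt; apply/negP => S_lt0.
have [yz|yz] := eqVneq y z.
  by move: S_lt0; rewrite yz !subrr dot0l dot0r !mulr0 !addr0 ltxx.
set S := (X in X < 0) in S_lt0.
have N0 : 0 < enorm (y - z) by rewrite enorm_gt0 subr_eq0.
have M0 : 0 < `|y - z| by rewrite normr_gt0 subr_eq0.
(* With this tolerance the linearization error of [psi] along the step is at most half of the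
   decrease [th * S]. *)
have eps0 : 0 < - S / (2 * enorm (y - z)).
  by rewrite divr_gt0 ?mulr_gt0// oppr_gt0.
have [del del0 near_z] := is_gradient_near dpsi eps0.
pose th := Num.min 1 (del / (2 * `|y - z|)).
have th0 : 0 < th by rewrite lt_min ltr01 divr_gt0// mulr_gt0.
have th1 : th <= 1 by rewrite ge_min lexx.
have thdel : th * `|y - z| < del.
  apply: (@le_lt_trans _ _ (del / (2 * `|y - z|) * `|y - z|)).
    by rewrite ler_wpM2r// ge_min lexx orbT.
  rewrite (_ : _ * _ = del / 2); first by rewrite ltr_pdivrMr// ltr_pMr// ltr1n.
  by field; rewrite gt_eqF.
pose t := Itv01 (ltW th0) th1.
have := cA y z t; rewrite !inE => /(_ Ay Az).
have := cr t y z; rewrite !inE => /(_ Ay Az); rewrite convRE /=.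
set u := conv _ _ _ => ru Au.
have uE : u = z + th *: (y - z).
  rewrite /u /conv /= /unstable.onem.
  by rewrite scalerBl scale1r scalerBr addrCA addrA.
have uz : u - z = th *: (y - z) by rewrite uE addrC addKr.
have u_neq : u != z.
  by rewrite -subr_eq0 uz scaler_eq0 negb_or gt_eqF//= subr_eq0.
have := near_z _ Au u_neq; rewrite uz normrZ (gtr0_norm th0) => /(_ thdel).
rewrite enormZ (gtr0_norm th0) dotZr ler_norml => /andP[_].
have -> : - S / (2 * enorm (y - z)) * (th * enorm (y - z)) = - S / 2 * th.
  by field; rewrite gt_eqF.
move=> psi_u; have := zmin _ Au.
have {}ru := ler_wpM2l al0 ru.
have Sth : S * th < 0 by rewrite pmulr_llt0.
move: Sth ru psi_u; rewrite /S uE /unstable.onem !(dotDl, dotDr, dotNl, dotNr, dotZl, dotZr).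
set d1 := dot z a; set d2 := dot y a; set d3 := dot gz y; set d4 := dot gz z.
set d5 := dot g y; set d6 := dot g z.
set rz := r z; set ry := r y; set ru := r _; set pz := psi z; set pu := psi _.
move=> *. lra.
Qed.

End MirrorStep.

(** * Analysis of a run *)

Section Run.
Context {R : realType} {n m : nat}.
Variables (P : problem R n m) (sigma : 'I_n -> R) (W : nat -> 'M[R]_n).
Variables (F G K d c kappa : R) (Phi : self_maps P).
Variables (x xt : nat -> profile P) (q : nat -> 'I_n -> 'cV[R]_m).

Let alpha (t : nat) : R := 1 / t%:R `^ c.
Let beta (t : nat) : R := 1 / t%:R `^ kappa.
Let gamma (t : nat) : R := 1 / t%:R `^ (1 - kappa).
Let B1 := 2 * F + G * d.
Let qt := q_tilde W q.

Hypothesis n_gt0 : (0 < n)%N.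
Hypothesis psi_mirror : mirror_map P sigma.
Hypothesis fun_assum : function_assumption P F G.
Hypothesis breg_lip : bregman_lipschitz P K.
Hypothesis diam : forall y z : profile P, inX y -> inX z -> pdist y z <= d.
Hypothesis Phi_id : forall i t z, (0 < t)%N -> dom P i z -> @Phi i t z = z.
Hypothesis kappa01 : 0 < kappa < 1.
Hypothesis dsW : forall t, (0 < t)%N -> doubly_stochastic (W t).
Hypothesis run : algorithm_run W Phi alpha beta gamma x xt q.

Let F_gt0 : 0 < F. Proof. by case: fun_assum. Qed.
Let G_gt0 : 0 < G. Proof. by case: fun_assum. Qed.
Let kappa_gt0 : 0 < kappa. Proof. by case/andP: kappa01. Qed.
Let kappa_lt1 : kappa < 1. Proof. by case/andP: kappa01. Qed.

(** * Iterates, distances and the primal step *)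

Lemma run_next s i : x s.+1 i = xt s.+1 i.
Proof. by rewrite (run_x run) Phi_id//; have [] := run_xt run s i. Qed.

Lemma run_dom s i : dom P i (x s i).
Proof.
case: s => [|s]; first exact: (run_x0 run).
by rewrite run_next; have [] := run_xt run s i.
Qed.

(** The diameter bounds distances of profiles, so both points are completed to profiles by the
    components of [x 0]. The dimension depends on the agent, hence the transport along [i = j] in
    [upd]. *)
Lemma agent_dist_le i y z : dom P i y -> dom P i z -> enorm (y - z) <= d.
Proof.
move=> Xy Xz.
pose upd (u : 'cV[R]_(Defs.dim P i)) : profile P := fun j =>
  if eqP is ReflectT e then eq_rect i (fun k => 'cV[R]_(Defs.dim P k)) u j e
  else x 0%N j.
have updE u : upd u i = u.
  rewrite /upd; case: eqP => // e.
  by rewrite (eq_irrelevance e erefl).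
have updX u : dom P i u -> inX (upd u).
  move=> Xu j; rewrite /upd; case: eqP => [e|_]; last exact: run_dom.
  by case: j / e.
apply: le_trans (diam (updX _ Xy) (updX _ Xz)).
rewrite /pdist -[leLHS]ger0_norm ?enorm_ge0// -sqrtr_sqr ler_wsqrtr//.
rewrite (bigD1 i)//= !updE lerDl sumr_ge0// => j _; exact: sqr_ge0.
Qed.

Lemma diam_ge0 : 0 <= d.
Proof. by apply: le_trans (diam (run_x0 run) (run_x0 run)); exact: sqrtr_ge0. Qed.

Lemma B1_ge0 : 0 <= B1.
Proof. by rewrite addr_ge0// mulr_ge0 ?diam_ge0// ltW. Qed.

Lemma bregman_ge i y z : dom P i y -> dom P i z ->
  sigma i / 2 * enorm (y - z) ^+ 2 <= bregman y z.
Proof.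
move=> Xy Xz; have [_ _ /(_ _ _ Xy Xz)] := psi_mirror i.
rewrite /bregman; lra.
Qed.

Lemma bregman_ge0 i (y z : 'cV[R]_(Defs.dim P i)) :
  dom P i y -> dom P i z -> 0 <= bregman y z.
Proof.
move=> Xy Xz; apply: le_trans (bregman_ge Xy Xz).
have [s0 _ _] := psi_mirror i.
by rewrite mulr_ge0 ?sqr_ge0// divr_ge0// ltW.
Qed.

(** The Lipschitz assumption compared with the point [z], at which the divergence from [z] is 0. *)
Lemma bregman_le i (y z : 'cV[R]_(Defs.dim P i)) :
  dom P i y -> dom P i z -> bregman y z <= K * d.
Proof.
move=> Xy Xz; have [K0 /(_ i _ _ _ Xy Xz Xz)] := breg_lip.
rewrite [bregman z z]/bregman !subrr dot0r subrr subr0.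
move=> /(le_trans (ler_norm _)) /le_trans; apply.
by apply: ler_wpM2l; [exact: ltW | exact: agent_dist_le].
Qed.

Lemma con_subgradient s i (y z : 'cV[R]_(Defs.dim P i)) k :
  (0 < s)%N -> dom P i y -> dom P i z ->
  (dcon P i s y *m (z - y) + con P i s y) k 0 <= con P i s z k 0.
Proof.
move=> s0 Xy Xz; have [_ _ /(_ k z Xz)] := fa_subgradient fun_assum s0 Xy.
apply: le_trans; rewrite mxE addrC lerD2l le_eqVlt; apply/orP; left; apply/eqP.
by rewrite mxE; apply: eq_bigr => j _; rewrite !mxE.
Qed.

Lemma dcon_enorm_le s i (y : 'cV[R]_(Defs.dim P i)) v :
  (0 < s)%N -> dom P i y -> enorm (dcon P i s y *m v) <= G * enorm v.
Proof.
move=> s0 Xy; apply: le_trans (ler_opnorm _ _) _.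
rewrite ler_wpM2r ?enorm_ge0//.
by have [_ _] := fa_gradient_bounded fun_assum s0 Xy.
Qed.

(** Optimality of [z = x s.+1 i] divided by [alpha], with the three-point identity [<dpsi z - dpsi
    x, y - z> = D(y, x) - D(y, z) - D(z, x)] for [x = x s i]. *)
Lemma primal_step s i y : (0 < s)%N -> dom P i y ->
  dot (x s.+1 i - y) (descent_dir W x q s i)
    + (rgl P i s (x s.+1 i) - rgl P i s y)
  <= s.+1%:R `^ c * (bregman y (x s i) - bregman y (x s.+1 i)
                     - bregman (x s.+1 i) (x s i)).
Proof.
move=> s0 Xy; have := run_xt run s i; rewrite -run_next.
set z := x s.+1 i; set a := descent_dir _ _ _ _ _ => zmin.
have Xz : dom P i z by exact: run_dom.
have a0 : 0 < s.+1%:R `^ c by rewrite powR_gt0.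
have [_ cr _] := fa_convex fun_assum i s0.
have [_ /(_ z Xz) gz _] := psi_mirror i.
have zmin' : is_argmin (dom P i) (fun u => alpha s.+1 * dot u a
    + alpha s.+1 * rgl P i s u + (psi P i u - dot (dpsi P i (x s i)) u)) z.
  split=> // u Xu; have [_ /(_ u Xu)] := zmin.
  rewrite /bregman !dotBr; lra.
have al0 : 0 <= alpha s.+1 by rewrite divr_ge0// powR_ge0.
have := argmin_variational (@fa_convex_set _ _ _ _ _ _ fun_assum i) cr al0 gz zmin' Xy.
move=> /(mulr_ge0 (ltW a0)).
have -> : s.+1%:R `^ c * (alpha s.+1 * dot (y - z) a
    + alpha s.+1 * (rgl P i s y - rgl P i s z)
    + dot (dpsi P i z - dpsi P i (x s i)) (y - z)) =
  dot (y - z) a + (rgl P i s y - rgl P i s z)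
    + s.+1%:R `^ c * dot (dpsi P i z - dpsi P i (x s i)) (y - z).
  by rewrite /alpha; field; rewrite gt_eqF.
rewrite /bregman !(dotBl, dotBr); lra.
Qed.

(** * Boundedness of the dual variables and the dual step *)

Lemma dual_ge0 s i k : 0 <= q s i k 0.
Proof.
case: s => [|s]; first by rewrite (run_q0 run) mxE.
by rewrite (run_q run) posE le_max lexx.
Qed.

Lemma q_tilde_ge0 s i k : (0 < s)%N -> 0 <= qt s i k 0.
Proof.
move=> /dsW[W0 _ _]; rewrite /qt /q_tilde summxE sumr_ge0// => j _.
by rewrite mxE mulr_ge0// dual_ge0.
Qed.

Lemma q_tilde_enorm_le s i (r : R) : (0 < s)%N ->
  (forall j, enorm (q s j) <= r) -> enorm (qt s i) <= r.
Proof.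
move=> /dsW[W0 rowW _] qr; apply: le_trans (enorm_sum _ _) _.
rewrite -[r]mul1r -(rowW i) mulr_suml ler_sum// => j _.
by rewrite enormZ ger0_norm// ler_wpM2l.
Qed.

(** All data of round 0 vanish, so the duals are still zero after the first update and the analysis
    can start at round 1, the first round with a doubly stochastic weight matrix by assumption. *)
Lemma dual1 i : q 1%N i = 0.
Proof.
have qt0 : qt 0 i = 0.
  by rewrite /qt /q_tilde big1// => j _; rewrite (run_q0 run) scaler0.
have [_ _ con0 _ dcon0] := run_zero run (run_x0 run i).
rewrite (run_q run) -/qt qt0 /con_lin con0 dcon0 mul0mx scaler0 !addr0.
rewrite subr0 scaler0 add0r.
by apply/matrixP => k j; rewrite !mxE maxxx.
Qed.

Lemma con_lin_le s i k : (0 < s)%N ->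
  con_lin x xt s i k 0 <= con P i s (x s.+1 i) k 0.
Proof.
by move=> s0; rewrite /con_lin -run_next con_subgradient//; exact: run_dom.
Qed.

Let gb s : gamma s.+1 * beta s.+1 = s.+1%:R^-1.
Proof. by rewrite /gamma /beta mul_inv_powR. Qed.

(* The bound uses that con_lin lies below the value of the constraint at the
   next iterate, so that [pos] of it has norm at most F. *)
Lemma dual_enorm_le s i : (0 < s)%N -> enorm (q s i) <= F * s%:R `^ kappa.
Proof.
elim: s i => [//|[_ i _|s IH i _]].
  by rewrite dual1 enorm0 mulr_ge0 ?powR_ge0// ltW.
set t := s.+1 in IH *; have t0 : (0 < t)%N by [].
have qtF : enorm (qt t i) <= F * t%:R `^ kappa.
  by apply: q_tilde_enorm_le => // j; exact: IH.
have g0 : 0 < gamma t.+1 by rewrite divr_gt0// powR_gt0.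
have b0 : 0 < t.+1%:R `^ kappa :> R by rewrite powR_gt0.
have gb1 : gamma t.+1 * beta t.+1 <= 1 by rewrite gb invf_le1// ler1n.
set g := pos (con P i t (x t.+1 i)).
have gF : enorm g <= F.
  rewrite (le_trans (enorm_pos_le _))//.
  by have [_ _] := fa_bounded fun_assum t0 (run_dom t.+1 i).
have q_le : enorm (q t.+1 i) <=
    enorm ((1 - gamma t.+1 * beta t.+1) *: qt t i + gamma t.+1 *: g).
  apply: ler_enorm => k; rewrite dual_ge0 (run_q run) posE -/qt.
  have qk := q_tilde_ge0 i k t0; have ck := con_lin_le i k t0.
  have gk : Num.max 0 (con P i t (x t.+1 i) k 0) = g k 0 by rewrite posE.
  have gk0 : 0 <= g k 0 by rewrite -gk le_max lexx.
  have gk1 : con P i t (x t.+1 i) k 0 <= g k 0 by rewrite -gk le_max lexx orbT.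
  have -> : ((1 - gamma t.+1 * beta t.+1) *: qt t i + gamma t.+1 *: g) k 0 =
     (1 - gamma t.+1 * beta t.+1) * qt t i k 0 + gamma t.+1 * g k 0 by rewrite !mxE.
  have -> : (qt t i + gamma t.+1 *: (con_lin x xt t i - beta t.+1 *: qt t i)) k 0 =
     qt t i k 0 + gamma t.+1 * (con_lin x xt t i k 0 - beta t.+1 * qt t i k 0).
    by rewrite !mxE.
  have H1 : 0 <= (1 - gamma t.+1 * beta t.+1) * qt t i k 0.
    by rewrite mulr_ge0// subr_ge0.
  rewrite ge_max addr_ge0 ?(mulr_ge0 (ltW g0))//=.
  have : gamma t.+1 * con_lin x xt t i k 0 <= gamma t.+1 * g k 0.
    by rewrite ler_pM2l// (le_trans ck).
  lra.
apply: (le_trans q_le); apply: le_trans (enormD _ _) _.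
rewrite !enormZ (ger0_norm (ltW g0)) ger0_norm ?subr_ge0//.
have tk : t%:R `^ kappa <= t.+1%:R `^ kappa :> R.
  by apply: ge0_ler_powR; rewrite ?nnegrE ?ler_nat// ltW.
have qtF' : enorm (qt t i) <= F * t.+1%:R `^ kappa.
  by rewrite (le_trans qtF)// ler_pM2l.
have H2 : (1 - gamma t.+1 * beta t.+1) * enorm (qt t i) <=
   (1 - gamma t.+1 * beta t.+1) * (F * t.+1%:R `^ kappa).
  by rewrite ler_wpM2l// subr_ge0.
have H3 : gamma t.+1 * enorm g <= gamma t.+1 * F by rewrite ler_pM2l.
(* [F / beta] is the fixed point of [r -> (1 - gamma * beta) * r + gamma * F], so the bound
   reproduces itself. *)
have H4 : gamma t.+1 * beta t.+1 * (F * t.+1%:R `^ kappa) = gamma t.+1 * F.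
  by rewrite /beta; field; rewrite gt_eqF.
lra.
Qed.

(** This is the origin of [B1]: the linearized constraint contributes [G * d + F], and the
    regularization contributes [F] since the duals are at most [F / beta]. *)
Lemma dual_increment_le s i : (0 < s)%N ->
  enorm (con_lin x xt s i - beta s.+1 *: qt s i) <= B1.
Proof.
move=> s0; have b0 : 0 < s.+1%:R `^ kappa :> R by rewrite powR_gt0.
have qtF : enorm (qt s i) <= F * s%:R `^ kappa.
  by apply: q_tilde_enorm_le => // j; exact: dual_enorm_le.
have sk : s%:R `^ kappa <= s.+1%:R `^ kappa :> R.
  by apply: ge0_ler_powR; rewrite ?nnegrE ?ler_nat// ltW.
have bq : enorm (beta s.+1 *: qt s i) <= F.
  rewrite enormZ ger0_norm ?divr_ge0 ?powR_ge0// /beta mulrAC mul1r.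
  by rewrite ler_pdivrMr// (le_trans qtF)// ler_pM2l.
have cl : enorm (con_lin x xt s i) <= G * d + F.
  rewrite (le_trans (enormD _ _))// lerD//.
    rewrite (le_trans (dcon_enorm_le _ s0 (run_dom s i)))// ler_pM2l//.
    by rewrite -run_next agent_dist_le//; exact: run_dom.
  by have [_ _] := fa_bounded fun_assum s0 (run_dom s i).
rewrite (le_trans (enormB _ _))// /B1; lra.
Qed.

(** Nonexpansiveness of the projection, the square expanded and multiplied by [1 / (2 gamma)].
    Polarizing [<q~ - qq, q~>] yields the decrement [beta]; the nonpositive term in the squared norm
    of [q~] is dropped. *)
Lemma dual_step s i (qq : 'cV[R]_m) : (0 < s)%N -> (forall k, 0 <= qq k 0) ->
  s.+1%:R `^ (1 - kappa) / 2 * enorm (q s.+1 i - qq) ^+ 2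
  <= (s.+1%:R `^ (1 - kappa) - beta s.+1) / 2 * enorm (qt s i - qq) ^+ 2
     + dot (qt s i - qq) (con_lin x xt s i)
     + gamma s.+1 * B1 ^+ 2 / 2 + beta s.+1 * enorm qq ^+ 2 / 2.
Proof.
move=> s0 qq0; set h := s.+1%:R `^ (1 - kappa).
have h0 : 0 < h by rewrite powR_gt0.
have gE : gamma s.+1 = h^-1 by rewrite /gamma div1r.
set b := con_lin x xt s i - beta s.+1 *: qt s i.
have : enorm (q s.+1 i - qq) ^+ 2 <= enorm (qt s i - qq + gamma s.+1 *: b) ^+ 2.
  rewrite lerXn2r ?nnegrE ?enorm_ge0// (run_q run) -/qt -/b.
  by rewrite (le_trans (pos_dist_le _ qq0))// addrAC.
have -> : enorm (qt s i - qq + gamma s.+1 *: b) ^+ 2 =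
    enorm (qt s i - qq) ^+ 2 + 2 * h^-1 * dot (qt s i - qq) b
    + h^-1 ^+ 2 * enorm b ^+ 2.
  have := enormB_sq (qt s i - qq) (- (h^-1 *: b)).
  rewrite opprK gE => ->; rewrite dotNr dotZr enormN enormZ exprMn.
  by rewrite real_normK ?num_real//; ring.
have bB : enorm b ^+ 2 <= B1 ^+ 2.
  rewrite lerXn2r ?nnegrE ?enorm_ge0 ?dual_increment_le//.
  by rewrite (le_trans _ (dual_increment_le i s0))// enorm_ge0.
have -> : dot (qt s i - qq) b = dot (qt s i - qq) (con_lin x xt s i)
   - beta s.+1 / 2 * (enorm (qt s i - qq) ^+ 2 + enorm (qt s i) ^+ 2
     - enorm qq ^+ 2).
  by rewrite /b dotBr dotZr enormB_sq !dotBl -!dotuu (dotC qq (qt s i)); field.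
have be0 : 0 <= beta s.+1 * enorm (qt s i) ^+ 2.
  by rewrite mulr_ge0 ?sqr_ge0// divr_ge0// powR_ge0.
set Y := enorm (qt s i - qq) ^+ 2; set Z := dot _ _.
move=> H.
have h2 : 0 <= h / 2 by rewrite divr_ge0// ltW.
have := ler_wpM2l h2 H.
have {H} := ler_wpM2l (ltW (divr_gt0 ltr01 h0)) bB.
rewrite gE; set U := enorm b ^+ 2; set V := enorm (qt s i) ^+ 2 in be0 *.
set bs := beta s.+1 in be0 *; set B2 := B1 ^+ 2; set Q2 := enorm qq ^+ 2.
have -> : h / 2 * (Y + 2 * h^-1 * (Z - bs / 2 * (Y + V - Q2)) + h^-1 ^+ 2 * U) =
  h / 2 * Y + Z - bs / 2 * (Y + V - Q2) + 1 / h * U / 2.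
  by field; rewrite gt_eqF.
rewrite div1r; lra.
Qed.

(** * Inequalities for one round, per agent and over the network *)

Let h (t : nat) : R := t%:R `^ (1 - kappa).
Let a (t : nat) : R := t%:R `^ c.
Let u s i := enorm (x s.+1 i - x s i).

(** Adding the primal and dual steps cancels [q~] against [dcon (x s.+1 - x s)]. The same increment
    against [qq] survives and is bounded by the last term; [q~ >= 0] and convexity replace the
    linearization at [y] by the constraint itself. *)
Lemma agent_step s i y (qq : 'cV[R]_m) :
  (0 < s)%N -> dom P i y -> (forall k, 0 <= qq k 0) ->
  dot (x s.+1 i - y) (dloss P i s (x s i))
    + (rgl P i s (x s.+1 i) - rgl P i s y)
    + h s.+1 / 2 * enorm (q s.+1 i - qq) ^+ 2 + dot qq (con P i s (x s i))
  <= dot (qt s i) (con P i s y)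
     + a s.+1 * (bregman y (x s i) - bregman y (x s.+1 i))
     - a s.+1 * (sigma i / 2 * u s i ^+ 2)
     + (h s.+1 - beta s.+1) / 2 * enorm (qt s i - qq) ^+ 2
     + gamma s.+1 * B1 ^+ 2 / 2 + beta s.+1 * enorm qq ^+ 2 / 2
     + G * enorm qq * u s i.
Proof.
move=> s0 Xy qq0; have Xx := run_dom s i; have Xx' := run_dom s.+1 i.
have a0 : 0 <= a s.+1 by exact: powR_ge0.
have := primal_step s0 Xy; have := dual_step i s0 qq0.
have := ler_wpM2l a0 (bregman_ge Xx' Xx).
set xn := x s.+1 i in Xx' *; set xs := x s i in Xx *.
have := ler_dot_pos (fun k => q_tilde_ge0 i k s0)
          (fun k => con_subgradient k s0 Xx Xy).
have : - dot qq (dcon P i s xs *m (xn - xs)) <= G * enorm qq * u s i.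
  rewrite -dotNl (le_trans (ler_dot _ _))// enormN (mulrC G) -mulrA.
  rewrite ler_wpM2l ?enorm_ge0//.
  exact: dcon_enorm_le.
rewrite /u -/xn -/xs /descent_dir /con_lin -run_next -/xn -/xs -/qt.
rewrite !(dotDr, dotBl) !(dotC _ (_^T *m _)) !dot_trmx_mulmx.
rewrite !mulmxBr !dotBr /h /a.
move=> {a0} *. lra.
Qed.

Let dual_mx s : 'M[R]_(n, m) := \matrix_(i, k) q s i k 0.
Let e s := frob (centered (dual_mx s)).
Let D (y : profile P) s := \sum_i bregman (y i) (x s i).
Let N (qq : 'cV[R]_m) s := \sum_i enorm (q s i - qq) ^+ 2.

Lemma row_mul_dual s i : (row i (W s *m dual_mx s))^T = qt s i.
Proof.
apply/matrixP => k j; rewrite (ord1 j) !mxE summxE; apply: eq_bigr => l _.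
by rewrite !mxE.
Qed.

(** Row sums 1 make averaging commute with subtracting [qq] from every row, and averaging does not
    increase the Frobenius norm. *)
Lemma q_tilde_dist_le s (qq : 'cV[R]_m) : (0 < s)%N ->
  \sum_i enorm (qt s i - qq) ^+ 2 <= N qq s.
Proof.
move=> s0; pose B : 'M[R]_(n, m) := \matrix_(i, k) (q s i k 0 - qq k 0).
have -> : N qq s = frob B ^+ 2.
  rewrite frob_row; apply: eq_bigr => i _; congr (enorm _ ^+ 2).
  by apply/matrixP => k j; rewrite (ord1 j) !mxE.
have -> : \sum_i enorm (qt s i - qq) ^+ 2 = frob (W s *m B) ^+ 2.
  rewrite frob_row; apply: eq_bigr => i _; congr (enorm _ ^+ 2).
  apply/matrixP => k j; rewrite (ord1 j) !mxE summxE.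
  have [_ rowW _] := dsW s0; rewrite -[X in _ - X]mul1r -(rowW i) mulr_suml -sumrB.
  by apply: eq_bigr => l _; rewrite !mxE mulrBr.
by rewrite lerXn2r ?nnegrE ?frob_ge0// stochastic_frob_le//; exact: dsW.
Qed.

(** The average [qbar] is nonnegative and meets only the total constraint at [y], which is
    nonpositive; the centered remainder is bounded by Cauchy-Schwarz. *)
Lemma dual_con_le s y : (0 < s)%N -> inX y ->
  (forall k, tot_con s y k 0 <= 0) ->
  \sum_i dot (qt s i) (con P i s (y i)) <= Num.sqrt n%:R * F * e s.
Proof.
move=> s0 Xy gy.
pose B : 'M[R]_(n, m) := \matrix_(i, k) con P i s (y i) k 0.
have BE i : (row i B)^T = con P i s (y i).
  by apply/matrixP => k j; rewrite (ord1 j) !mxE.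
pose qbar := (row_mean (W s *m dual_mx s))^T.
have qtE i : qt s i = qbar + (row i (W s *m centered (dual_mx s)))^T.
  rewrite -centered_mul; last exact: dsW.
  apply/matrixP => k j; rewrite (ord1 j) -row_mul_dual !mxE; ring.
have qbar0 k : 0 <= qbar k 0.
  rewrite mxE row_meanE mulr_ge0 ?invr_ge0// sumr_ge0// => i _.
  have -> : (W s *m dual_mx s) i k = qt s i k 0 by rewrite -row_mul_dual !mxE.
  exact: q_tilde_ge0.
have -> : \sum_i dot (qt s i) (con P i s (y i)) = dot qbar (tot_con s y) +
    \sum_i dot (row i (W s *m centered (dual_mx s)))^T (row i B)^T.
  rewrite /tot_con dot_sumr -big_split; apply: eq_bigr => i _.
  by rewrite qtE dotDl BE.
rewrite -[leRHS]add0r lerD//.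
  rewrite -(dot0r qbar); apply: ler_dot_pos => // k.
  by rewrite [leRHS]mxE.
apply: (@le_trans _ _ (Num.sqrt n%:R * F * frob (W s *m centered (dual_mx s)))).
  apply: dot_rows_le; first exact: ltW.
  by move=> i; rewrite BE; have [_ _] := fa_bounded fun_assum s0 (Xy i).
rewrite ler_wpM2l ?mulr_ge0 ?sqrtr_ge0//; first exact: ltW.
by apply: stochastic_frob_le; exact: dsW.
Qed.

(** The sum over agents, in telescoping form: the coefficient [h s.+1 - beta s.+1] is at most [h s],
    and the distances of the [q~] from [qq] are at most those of the [q]. *)
Lemma network_step s y (qq : 'cV[R]_m) : (0 < s)%N -> inX y ->
  (forall k, tot_con s y k 0 <= 0) -> (forall k, 0 <= qq k 0) ->
  \sum_i (dot (x s.+1 i - y i) (dloss P i s (x s i))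
          + (rgl P i s (x s.+1 i) - rgl P i s (y i)))
    + (h s.+1 / 2 * N qq s.+1 - h s / 2 * N qq s) + dot qq (tot_con s (x s))
  <= Num.sqrt n%:R * F * e s + a s.+1 * (D y s - D y s.+1)
     + n%:R * (gamma s.+1 * B1 ^+ 2 / 2 + beta s.+1 * enorm qq ^+ 2 / 2)
     + \sum_i (G * enorm qq * u s i - a s.+1 * (sigma i / 2 * u s i ^+ 2)).
Proof.
move=> s0 Xy gy qq0.
have sum_const (z : R) : n%:R * z = \sum_(i < n) z.
  by rewrite sumr_const card_ord mulr_natl.
have -> : \sum_i (dot (x s.+1 i - y i) (dloss P i s (x s i))
        + (rgl P i s (x s.+1 i) - rgl P i s (y i)))
      + (h s.+1 / 2 * N qq s.+1 - h s / 2 * N qq s) + dot qq (tot_con s (x s)) =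
    \sum_i (dot (x s.+1 i - y i) (dloss P i s (x s i))
      + (rgl P i s (x s.+1 i) - rgl P i s (y i))
      + h s.+1 / 2 * enorm (q s.+1 i - qq) ^+ 2 + dot qq (con P i s (x s i)))
    - h s / 2 * N qq s.
  by rewrite dot_sumr /N [X in _ + (X - _) + _]mulr_sumr !big_split /=; ring.
rewrite lerBlDr.
rewrite (le_trans (ler_sum _ (fun i _ => agent_step s0 (Xy i) qq0)))//.
have -> : \sum_i (dot (qt s i) (con P i s (y i))
     + a s.+1 * (bregman (y i) (x s i) - bregman (y i) (x s.+1 i))
     - a s.+1 * (sigma i / 2 * u s i ^+ 2)
     + (h s.+1 - beta s.+1) / 2 * enorm (qt s i - qq) ^+ 2
     + gamma s.+1 * B1 ^+ 2 / 2 + beta s.+1 * enorm qq ^+ 2 / 2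
     + G * enorm qq * u s i) =
   \sum_i dot (qt s i) (con P i s (y i)) + a s.+1 * (D y s - D y s.+1)
     + (h s.+1 - beta s.+1) / 2 * (\sum_i enorm (qt s i - qq) ^+ 2)
     + n%:R * (gamma s.+1 * B1 ^+ 2 / 2 + beta s.+1 * enorm qq ^+ 2 / 2)
     + \sum_i (G * enorm qq * u s i - a s.+1 * (sigma i / 2 * u s i ^+ 2)).
  rewrite sum_const -sumrB !mulr_sumr -!big_split /=.
  by apply: eq_bigr => i _; ring.
have dc := dual_con_le s0 Xy gy.
have hN : (h s.+1 - beta s.+1) / 2 * (\sum_i enorm (qt s i - qq) ^+ 2)
    <= h s / 2 * N qq s.
  apply: (@le_trans _ _ (h s / 2 * (\sum_i enorm (qt s i - qq) ^+ 2))).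
    rewrite ler_wpM2r ?sumr_ge0// => [i _|]; first exact: sqr_ge0.
    by rewrite ler_pM2r ?invr_gt0// powR_succ_decay_le// ltW.
  by rewrite ler_wpM2l ?q_tilde_dist_le// divr_ge0// powR_ge0.
lra.
Qed.

(** Since [q~] already lies in the orthant, projecting moves each agent by at most [gamma * B1] from
    it; over [n] agents this gives the factor [sqrt n]. *)
Lemma dual_residual_le s : (0 < s)%N ->
  frob (dual_mx s.+1 - W s *m dual_mx s) <= Num.sqrt n%:R * B1 * gamma s.+1.
Proof.
move=> s0; have g0 : 0 < gamma s.+1 by rewrite divr_gt0// powR_gt0.
have B0 : 0 <= B1 * gamma s.+1 by rewrite mulr_ge0 ?B1_ge0 ?ltW.
rewrite -mulrA -(@ler_pXn2r _ 2)// ?nnegrE ?frob_ge0 ?(mulr_ge0 (sqrtr_ge0 _) B0)//.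
rewrite exprMn (sqr_sqrtr (ler0n R n)) frob_row mulr_natl -[n in _ *+ n]card_ord -sumr_const.
apply: ler_sum => i _; rewrite lerXn2r ?nnegrE ?enorm_ge0//.
have -> : (row i (dual_mx s.+1 - W s *m dual_mx s))^T = q s.+1 i - qt s i.
  by rewrite linearB /= linearB /= row_mul_dual; congr (_ - _);
    apply/matrixP => k j; rewrite (ord1 j) !mxE.
rewrite (run_q run) -/qt.
apply: le_trans (pos_dist_le _ (fun k => q_tilde_ge0 i k s0)) _.
rewrite addrC addKr enormZ (gtr0_norm g0) mulrC ler_pM2r//.
exact: dual_increment_le.
Qed.

(** * Consensus error of the run *)

Variables (E : nat -> rel 'I_n) (w : R) (iota : nat).
Hypothesis graph : graph_assumption E W w iota.

(** A path from [S] to its complement in the union graph of the window has an edge leaving [S]. *)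
Lemma window_cross s (S : {set 'I_n}) i j : (0 < s)%N -> i \in S -> j \notin S ->
  exists k i' j',
    [/\ (k < iota)%N, (i' \in S) != (j' \in S) & 0 < W (s + k)%N i' j'].
Proof.
move=> s0 iS jS; have [_ _ gr] := graph.
have [_ _ _ _ /(_ i j)] := gr s s0.
move=> /connectP[p pth jE]; move: jS; rewrite jE {jE}.
elim: p i iS pth => [i iS _ /negP//|l p IH i iS /= /andP[il pth] lastS].
have [lS|lS] := boolP (l \in S); first exact: IH lS pth lastS.
have /existsP[k Eil] := il.
(* An edge from [i] to [l] makes the weight in row [l] (the receiver) and column [i] positive. *)
exists k, l, i; split; [exact: ltn_ord | by rewrite iS (negbTE lS) |].
have [Wpos _ _ _ _] := gr (s + k)%N (ltn_addr _ s0).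
by apply: Wpos; rewrite Eil.
Qed.

(** The window factor [1 - 2 w / n^3] for squared norms is at most the square of
    [rho = 1 - w / n^3], so [1 / (1 - rho) = n^3 / w]. *)
Lemma sum_disagreement_run (T : nat) :
  \sum_(1 <= t < T.+1) e t <=
  Num.sqrt n%:R * B1 * iota%:R * n%:R ^+ 3 / w * \sum_(1 <= t < T.+1) gamma t.
Proof.
have [/andP[w0 w1] iota0 gr] := graph.
have n1 : 1 <= n%:R :> R by rewrite ler1n.
have n3 : 1 <= n%:R ^+ 3 :> R by rewrite exprn_ege1.
have n3_gt0 : 0 < n%:R ^+ 3 :> R by rewrite (lt_le_trans ltr01).
pose rho := 1 - w / n%:R ^+ 3.
have wn0 : 0 < w / n%:R ^+ 3 by rewrite divr_gt0.
have wn : w / n%:R ^+ 3 <= 1.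
  by rewrite ler_pdivrMr// mul1r (le_trans (ltW w1)).
have rho0 : 0 <= rho by rewrite subr_ge0.
have contr s (v : 'cV[R]_n) : (0 < s)%N -> \sum_i v i 0 = 0 ->
    enorm (transition W s iota *m v) ^+ 2 <= rho ^+ 2 * enorm v ^+ 2.
  move=> s0 v0; have W0 k : (0 < s + k)%N by rewrite ltn_addr.
  have := @window_contraction R n W s iota v w (ltW w0) _ _ _ v0.
  move=> /(_ (fun k _ => dsW (W0 k))) H.
  apply: (le_trans (H _ _)).
  - move=> k i j _; have [Wpos _ Wle _ _] := gr _ (W0 k).
    move=> ij; apply: Wle; case/orP: ij => // ij.
    by apply: Wpos; rewrite ij orbT.
  - by move=> S i j; exact: window_cross.
  rewrite ler_wpM2r ?sqr_ge0// -subr_ge0.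
  rewrite (_ : _ - _ = (w / n%:R ^+ 3) ^+ 2) ?sqr_ge0// /rho.
  by field; rewrite gt_eqF// ltr0n.
have eps0 t : 0 <= Num.sqrt n%:R * B1 * gamma t.
  by rewrite !mulr_ge0 ?sqrtr_ge0 ?B1_ge0// invr_ge0 powR_ge0.
have dual0 : dual_mx 0%N = 0.
  by apply/matrixP => i k; rewrite mxE (run_q0 run) !mxE.
have dual1' : dual_mx 1%N = 0.
  by apply/matrixP => i k; rewrite mxE dual1 !mxE.
(* By convention [0 ^ (1 - kappa)] and its inverse are both 0, so the error sequence vanishes at
   index 0. *)
have g0 : Num.sqrt n%:R * B1 * gamma 0%N = 0.
  by rewrite /gamma powR0 ?invr0 ?mulr0// subr_eq0 gt_eqF.
have := sum_disagreement_le dsW dual_residual_le T rho0 iota0 dual0 dual1' g0 eps0 contr.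
rewrite -mulr_sumr /rho subKr mulrC -ler_pdivlMr// => /le_trans; apply.
rewrite le_eqVlt; apply/orP; left; apply/eqP.
by field; rewrite !gt_eqF// ltr0n.
Qed.

(** * Regret and constraint violation of one round *)

Variables (mu : 'I_n -> R) (sm mm : R).
Hypothesis sc : strongly_convex_losses P mu.
Hypothesis sm_gt0 : 0 < sm.
Hypothesis sm_le : forall i, sm <= sigma i.
Hypothesis mm_le : forall i, mm <= mu i.

Let a_gt0 s : 0 < a s.+1. Proof. by rewrite powR_gt0. Qed.

(** Completing the square in [u]: the mirror step's quadratic term pays for any term linear in the
    displacement. *)
Lemma linear_quadratic_le s i (b : R) :
  b * u s i - a s.+1 * (sigma i / 2 * u s i ^+ 2)
    <= b ^+ 2 / (2 * sm) * alpha s.+1.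
Proof.
have a0 := a_gt0 s.
have H : a s.+1 * (sm / 2 * u s i ^+ 2) <= a s.+1 * (sigma i / 2 * u s i ^+ 2).
  by rewrite ler_pM2l// ler_wpM2r ?sqr_ge0// ler_pM2r// invr_gt0.
have : 0 <= (a s.+1 * sm * u s i - b) ^+ 2 / (2 * a s.+1 * sm).
  by rewrite divr_ge0 ?sqr_ge0// !mulr_ge0// ltW.
have -> : (a s.+1 * sm * u s i - b) ^+ 2 / (2 * a s.+1 * sm) =
  a s.+1 * (sm / 2 * u s i ^+ 2) - b * u s i + b ^+ 2 / (2 * sm) * alpha s.+1.
  by rewrite /alpha -/(a s.+1); field; rewrite !gt_eqF.
lra.
Qed.

(** Dual comparator 0. Passing from [x s.+1] to [x s] in the loss and the regularizer costs
    [2 * G * u] per agent, which the quadratic term absorbs; strong convexity contributes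
    [- mm * D]. *)
Lemma regret_step s y : (0 < s)%N -> inX y ->
  (forall k, tot_con s y k 0 <= 0) ->
  tot_loss s (x s) - tot_loss s y
    + (h s.+1 / 2 * N 0 s.+1 - h s / 2 * N 0 s)
  <= Num.sqrt n%:R * F * e s
     + (a s.+1 * (D y s - D y s.+1) - mm * D y s)
     + n%:R * (B1 ^+ 2 / 2) * gamma s.+1
     + n%:R * (2 * G ^+ 2 / sm) * alpha s.+1.
Proof.
move=> s0 Xy gy.
have zero_ge0 k : 0 <= (0 : 'cV[R]_m) k 0 by rewrite mxE.
have := network_step s0 Xy gy zero_ge0.
rewrite dot0l enorm0 addr0 expr0n /= !mulr0 mul0r addr0.
under [X in _ <= _ + X]eq_bigr do rewrite mul0r sub0r.
rewrite sumrN => net.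
have agent i : loss P i s (x s i) + rgl P i s (x s i)
      - (loss P i s (y i) + rgl P i s (y i)) + mm * bregman (y i) (x s i)
    <= dot (x s.+1 i - y i) (dloss P i s (x s i))
       + (rgl P i s (x s.+1 i) - rgl P i s (y i)) + 2 * G * u s i.
  have Xx := run_dom s i; have Xx' := run_dom s.+1 i.
  have [_ /(_ s _ _ s0 (Xy i) Xx)] := sc i.
  have [_ /(_ _ Xx') rs _] := fa_subgradient fun_assum s0 Xx.
  have [dl dr _] := fa_gradient_bounded fun_assum s0 Xx.
  have mD := ler_wpM2r (bregman_ge0 (Xy i) Xx) (mm_le i).
  have r1 : - dot (drgl P i s (x s i)) (x s.+1 i - x s i) <= G * u s i.
    rewrite -dotNl (le_trans (ler_dot _ _))// enormN.
    by rewrite ler_wpM2r ?enorm_ge0.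
  have r2 : - dot (x s.+1 i - x s i) (dloss P i s (x s i)) <= G * u s i.
    rewrite dotC -dotNl (le_trans (ler_dot _ _))// enormN.
    by rewrite ler_wpM2r ?enorm_ge0.
  move: r1 r2 rs mD; rewrite !dotBl; lra.
have sum_agent : \sum_i (loss P i s (x s i) + rgl P i s (x s i)
      - (loss P i s (y i) + rgl P i s (y i)) + mm * bregman (y i) (x s i))
    <= \sum_i (dot (x s.+1 i - y i) (dloss P i s (x s i))
       + (rgl P i s (x s.+1 i) - rgl P i s (y i)) + 2 * G * u s i).
  by apply: ler_sum => i _; exact: agent.
have quad : \sum_i (2 * G * u s i - a s.+1 * (sigma i / 2 * u s i ^+ 2))
    <= n%:R * (2 * G ^+ 2 / sm) * alpha s.+1.
  have -> : n%:R * (2 * G ^+ 2 / sm) * alpha s.+1 =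
      \sum_(i < n) 2 * G ^+ 2 / sm * alpha s.+1.
    rewrite sumr_const card_ord -[RHS]mulr_natl; ring.
  apply: ler_sum => i _; apply: le_trans (linear_quadratic_le _ _ _) _.
  rewrite le_eqVlt; apply/orP; left; apply/eqP.
  by field; rewrite gt_eqF.
move: sum_agent quad net.
rewrite /tot_loss !(big_split, sumrN) /= -!mulr_sumr -/(D y s).
lra.
Qed.

(** The loss terms are only bounded below, by [- 2 * G * v] with [v] the distance to the comparator.
    Young's inequality and [sm / 2 * v^2 <= K * d] express this through quantities that also occur
    in [C1]. *)
Lemma violation_step s y (qq : 'cV[R]_m) : (0 < s)%N -> inX y ->
  (forall k, tot_con s y k 0 <= 0) -> (forall k, 0 <= qq k 0) ->
  dot qq (tot_con s (x s)) + (h s.+1 / 2 * N qq s.+1 - h s / 2 * N qq s)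
  <= Num.sqrt n%:R * F * e s + a s.+1 * (D y s - D y s.+1)
     + n%:R * (B1 ^+ 2 / 2) * gamma s.+1
     + n%:R * (8 * G ^+ 2 / sm + K * d / 2)
     + enorm qq ^+ 2 * (n%:R / 2 * beta s.+1
                        + n%:R * (G ^+ 2 / (2 * sm)) * alpha s.+1).
Proof.
move=> s0 Xy gy qq0; have net := network_step s0 Xy gy qq0.
have sum_agent : - (n%:R * (8 * G ^+ 2 / sm + K * d / 2)) <=
    \sum_i (dot (x s.+1 i - y i) (dloss P i s (x s i))
            + (rgl P i s (x s.+1 i) - rgl P i s (y i))).
  have -> : - (n%:R * (8 * G ^+ 2 / sm + K * d / 2)) =
      \sum_(i < n) - (8 * G ^+ 2 / sm + K * d / 2).
    by rewrite sumr_const card_ord -[RHS]mulr_natl mulrN.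
  apply: ler_sum => i _.
  have Xx := run_dom s i; have Xx' := run_dom s.+1 i.
  have [dl _ _] := fa_gradient_bounded fun_assum s0 Xx.
  have [_ dr _] := fa_gradient_bounded fun_assum s0 (Xy i).
  have [_ /(_ _ Xx') rs _] := fa_subgradient fun_assum s0 (Xy i).
  set v := enorm (x s.+1 i - y i).
  have r1 : - dot (drgl P i s (y i)) (x s.+1 i - y i) <= G * v.
    rewrite -dotNl (le_trans (ler_dot _ _))// enormN.
    by rewrite ler_wpM2r ?enorm_ge0.
  have r2 : - dot (x s.+1 i - y i) (dloss P i s (x s i)) <= G * v.
    rewrite dotC -dotNl (le_trans (ler_dot _ _))// enormN.
    by rewrite ler_wpM2r ?enorm_ge0.
  have Dv := le_trans (bregman_ge Xx' (Xy i)) (bregman_le Xx' (Xy i)).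
  have sv : sm / 2 * v ^+ 2 <= sigma i / 2 * v ^+ 2.
    by rewrite ler_wpM2r ?sqr_ge0// ler_pM2r// invr_gt0.
  have : 0 <= (sm * v - 4 * G) ^+ 2 / (4 * sm) + 4 * G ^+ 2 / sm.
    apply: addr_ge0; apply: divr_ge0; rewrite ?sqr_ge0// ?mulr_ge0 ?sqr_ge0//;
      exact: ltW.
  have -> : (sm * v - 4 * G) ^+ 2 / (4 * sm) + 4 * G ^+ 2 / sm =
    sm / 4 * v ^+ 2 - 2 * G * v + 8 * G ^+ 2 / sm.
    by field; rewrite gt_eqF.
  move: Dv sv; rewrite -/v; lra.
have quad : \sum_i (G * enorm qq * u s i - a s.+1 * (sigma i / 2 * u s i ^+ 2))
    <= enorm qq ^+ 2 * (n%:R * (G ^+ 2 / (2 * sm)) * alpha s.+1).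
  have -> : enorm qq ^+ 2 * (n%:R * (G ^+ 2 / (2 * sm)) * alpha s.+1) =
     \sum_(i < n) (G * enorm qq) ^+ 2 / (2 * sm) * alpha s.+1.
    rewrite sumr_const card_ord -[RHS]mulr_natl exprMn; ring.
  by apply: ler_sum => i _; exact: linear_quadratic_le.
lra.
Qed.

(** * Summation over the rounds *)

Hypothesis c01 : 0 < c < 1.
Let c_gt0 : 0 < c. Proof. by case/andP: c01. Qed.
Let c_lt1 : c < 1. Proof. by case/andP: c01. Qed.

Let Dmax := n%:R * (K * d).

Lemma divergence_bounds y s : inX y -> 0 <= D y s <= Dmax.
Proof.
move=> Xy; have Xx := run_dom s; apply/andP; split.
  by apply: sumr_ge0 => i _; exact: bregman_ge0.
rewrite /Dmax mulr_natl -[n in _ *+ n]card_ord -sumr_const.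
by apply: ler_sum => i _; exact: bregman_le.
Qed.

Lemma ler_sum_succ (T : nat) k p : 0 <= k -> 0 < p -> p <= 1 -> k = 1 - p ->
  \sum_(1 <= t < T.+1) 1 / t.+1%:R `^ k <= T%:R `^ p / p :> R.
Proof.
move=> k0 p0 p1 kE; rewrite (le_trans _ (sum_powR_le T p0 p1))// -kE.
rewrite !big_nat; apply: ler_sum => t /andP[t0 _].
by rewrite ler_inv_powR ?ltr0n// ler_nat.
Qed.

(** The two factors [sqrt n], from the pairing and from the residual, combine to the fourth power of
    [n]. *)
Lemma consensus_cost_le (T : nat) :
  Num.sqrt n%:R * F * \sum_(1 <= t < T.+1) e t
  <= n%:R ^+ 4 * iota%:R * F * B1 / w * (T%:R `^ kappa / kappa).
Proof.
have [/andP[w0 _] _ _] := graph.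
have nF : 0 <= Num.sqrt n%:R * F by rewrite mulr_ge0 ?sqrtr_ge0// ltW.
apply: le_trans (ler_wpM2l nF (sum_disagreement_run T)) _.
have n_sq : Num.sqrt n%:R * Num.sqrt n%:R = n%:R :> R by rewrite -expr2 sqr_sqrtr.
have -> : Num.sqrt n%:R * F * (Num.sqrt n%:R * B1 * iota%:R * n%:R ^+ 3 / w
      * \sum_(1 <= t < T.+1) gamma t) =
   (Num.sqrt n%:R * Num.sqrt n%:R) * n%:R ^+ 3 * iota%:R * F * B1 / w
      * \sum_(1 <= t < T.+1) gamma t by ring.
rewrite n_sq -exprS; apply: ler_wpM2l.
  by rewrite divr_ge0 ?(ltW w0)// !mulr_ge0 ?exprn_ge0 ?B1_ge0 ?(ltW F_gt0).
exact: sum_powR_le (ltW kappa_lt1).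
Qed.

(** Summation by parts with [a] nondecreasing; the induction carries the stronger bound
    [a T.+1 * (Dmax - D y T.+1)]. *)
Lemma sum_bregman_le y (T : nat) : inX y ->
  \sum_(1 <= s < T.+1) a s.+1 * (D y s - D y s.+1) <= Dmax * a T.+1.
Proof.
move=> Xy; have Dy s := divergence_bounds s Xy.
suff : \sum_(1 <= s < T.+1) a s.+1 * (D y s - D y s.+1) <=
    a T.+1 * (Dmax - D y T.+1).
  have /andP[D0 _] := Dy T.+1.
  have := mulr_ge0 (ltW (a_gt0 T)) D0; lra.
elim: T => [|T IH].
  rewrite big_geq// mulr_ge0 ?(ltW (a_gt0 _))// subr_ge0.
  by have /andP[] := Dy 1%N.
rewrite big_nat_recr//=.
have /andP[D0 D1] := Dy T.+1.
have aa : a T.+1 <= a T.+2.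
  by apply: ge0_ler_powR; rewrite ?nnegrE ?ler_nat// ltW.
have := ler_wpM2r (_ : 0 <= Dmax - D y T.+1) aa; rewrite subr_ge0 => /(_ D1); lra.
Qed.

(* Past round B the strong convexity absorbs the growth of 1 / alpha. *)
Lemma sum_bregman_strong_le y (B T : nat) : inX y -> c = 1 - kappa ->
  (0 < B)%N -> (forall t, (B <= t)%N -> 1 / t%:R `^ kappa <= mm) -> 0 <= mm ->
  \sum_(1 <= s < T.+1) (a s.+1 * (D y s - D y s.+1) - mm * D y s) <= Dmax * a B.
Proof.
move=> Xy cE B0 Bmm mm0; have Dy s := divergence_bounds s Xy.
have Dmax0 : 0 <= Dmax by have /andP[/le_trans] := Dy 0%N; apply.
have a_mono s t : (s <= t)%N -> a s <= a t.
  move=> st; apply: ge0_ler_powR; rewrite ?nnegrE ?ler_nat//; exact: ltW.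
(* The strengthened invariant keeps the last divergence on the left; its right side grows with [a]
   until round [B] and is constant afterwards. *)
suff : \sum_(1 <= s < T.+1) (a s.+1 * (D y s - D y s.+1) - mm * D y s)
    + a T.+1 * D y T.+1 <= Dmax * a (minn T.+1 B).
  have /andP[D0 _] := Dy T.+1.
  have := mulr_ge0 (ltW (a_gt0 T)) D0.
  have := ler_wpM2l Dmax0 (a_mono _ _ (geq_minr T.+1 B)); lra.
elim: T => [|T IH].
  rewrite big_geq// add0r (minn_idPl B0) mulrC ler_pM2r ?a_gt0//.
  by have /andP[] := Dy 1%N.
rewrite big_nat_recr//=.
have /andP[D0 D1] := Dy T.+1.
suff : (a T.+2 - a T.+1 - mm) * D y T.+1 <=
    Dmax * (a (minn T.+2 B) - a (minn T.+1 B)) by lra.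
have [TB|BT] := ltnP T.+1 B.
  rewrite (minn_idPl TB) mulrC.
  have aT : 0 <= a T.+2 - a T.+1 by rewrite subr_ge0 a_mono.
  have := ler_wpM2l aT D1; have := mulr_ge0 mm0 D0; lra.
rewrite (minn_idPr (leqW BT)) subrr mulr0.
apply: mulr_le0_ge0 => //.
have := powR_succ_diff_le (ltW kappa_gt0) (ltn0Sn T); have := Bmm _ BT.
rewrite /a cE; lra.
Qed.

Let M0 := n%:R ^+ 4 * iota%:R * F * B1 / w.

(** The dual distances telescope from 0 at round 1 to a nonnegative value. The Bregman sum is left
    open, to be bounded with or without strong convexity. *)
Lemma cum_loss_gap_le (T : nat) (y : profile P) : inX y ->
  (forall t k, (1 <= t <= T)%N -> tot_con t y k 0 <= 0) ->
  cum_loss T x - cum_loss T (fun=> y) <=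
  (M0 + n%:R * (B1 ^+ 2 / 2)) * (T%:R `^ kappa / kappa)
  + n%:R * (2 * G ^+ 2 / sm) * (T%:R `^ (1 - c) / (1 - c))
  + \sum_(1 <= s < T.+1) (a s.+1 * (D y s - D y s.+1) - mm * D y s).
Proof.
move=> Xy gy.
have steps : \sum_(1 <= s < T.+1) (tot_loss s (x s) - tot_loss s y
    + (h s.+1 / 2 * N 0 s.+1 - h s / 2 * N 0 s)) <=
  \sum_(1 <= s < T.+1) (Num.sqrt n%:R * F * e s
     + (a s.+1 * (D y s - D y s.+1) - mm * D y s)
     + n%:R * (B1 ^+ 2 / 2) * gamma s.+1
     + n%:R * (2 * G ^+ 2 / sm) * alpha s.+1).
  rewrite !big_nat; apply: ler_sum => s /andP[s0 sT].
  by apply: regret_step => // k; apply: gy; rewrite s0.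
move: steps; rewrite [leLHS]big_split /= [leRHS]big_split /=.
rewrite [X in _ <= X + _]big_split /= [X in _ <= X + _ + _]big_split /=.
rewrite (telescope_sumr (fun s => h s / 2 * N 0 s))//.
have -> : N 0 1%N = 0.
  by rewrite /N big1// => i _; rewrite dual1 subrr enorm0 expr0n.
have hN : 0 <= h T.+1 / 2 * N 0 T.+1.
  rewrite mulr_ge0 ?divr_ge0 ?powR_ge0//.
  by apply: sumr_ge0 => i _; exact: sqr_ge0.
have cons := consensus_cost_le T.
have gam : \sum_(1 <= s < T.+1) gamma s.+1 <= T%:R `^ kappa / kappa.
  by apply: ler_sum_succ => //; rewrite ?subr_ge0 ltW.
have alp : \sum_(1 <= s < T.+1) alpha s.+1 <= T%:R `^ (1 - c) / (1 - c).
  by apply: ler_sum_succ => //; rewrite ?subr_gt0 ?subKr// ?lerBlDr ?lerDl ltW.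
have {gam} gam : n%:R * (B1 ^+ 2 / 2) * (\sum_(1 <= s < T.+1) gamma s.+1) <=
    n%:R * (B1 ^+ 2 / 2) * (T%:R `^ kappa / kappa).
  by rewrite ler_wpM2l// mulr_ge0// divr_ge0 ?sqr_ge0.
have {alp} alp : n%:R * (2 * G ^+ 2 / sm) * (\sum_(1 <= s < T.+1) alpha s.+1) <=
    n%:R * (2 * G ^+ 2 / sm) * (T%:R `^ (1 - c) / (1 - c)).
  rewrite ler_wpM2l// mulr_ge0// divr_ge0 ?mulr_ge0 ?sqr_ge0//; exact: ltW.
rewrite mulr_sumr in cons; rewrite mulr_sumr in gam; rewrite mulr_sumr in alp.
rewrite /cum_loss /M0 -sumrB /=; lra.
Qed.

Lemma cum_loss_gap_convex_le (T : nat) (y : profile P) : 0 <= mm -> inX y ->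
  (forall t k, (1 <= t <= T)%N -> tot_con t y k 0 <= 0) ->
  cum_loss T x - cum_loss T (fun=> y) <=
  (M0 + n%:R * (B1 ^+ 2 / 2)) * (T%:R `^ kappa / kappa)
  + n%:R * (2 * G ^+ 2 / sm) * (T%:R `^ (1 - c) / (1 - c))
  + Dmax * T.+1%:R `^ c.
Proof.
move=> mm0 Xy gy; rewrite (le_trans (cum_loss_gap_le Xy gy))// lerD2l.
rewrite (le_trans _ (sum_bregman_le T Xy))// ler_sum// => s _.
by rewrite lerBlDr lerDl mulr_ge0//; have /andP[] := divergence_bounds s Xy.
Qed.

Lemma cum_loss_gap_strong_le (T B : nat) (y : profile P) : 0 <= mm -> inX y ->
  (forall t k, (1 <= t <= T)%N -> tot_con t y k 0 <= 0) ->
  c = 1 - kappa -> (0 < B)%N ->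
  (forall t, (B <= t)%N -> 1 / t%:R `^ kappa <= mm) ->
  cum_loss T x - cum_loss T (fun=> y) <=
  (M0 + n%:R * (B1 ^+ 2 / 2)) * (T%:R `^ kappa / kappa)
  + n%:R * (2 * G ^+ 2 / sm) * (T%:R `^ (1 - c) / (1 - c))
  + Dmax * B%:R `^ c.
Proof.
move=> mm0 Xy gy cE B0 Bmm; rewrite (le_trans (cum_loss_gap_le Xy gy))// lerD2l.
exact: sum_bregman_strong_le.
Qed.

(** An upper bound of the form [A + b * |qq|^2], ready for optimization over [qq]. The summand [+ 1]
    in [b] is the initial dual distance, since [q 1 = 0]. *)
Lemma cum_con_le (T : nat) (y : profile P) (qq : 'cV[R]_m) : inX y ->
  (forall t k, (1 <= t <= T)%N -> tot_con t y k 0 <= 0) ->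
  (forall k, 0 <= qq k 0) ->
  dot qq (\sum_(1 <= t < T.+1) tot_con t (x t)) <=
  (M0 + n%:R * (B1 ^+ 2 / 2)) * (T%:R `^ kappa / kappa)
  + Dmax * T.+1%:R `^ c + n%:R * (8 * G ^+ 2 / sm + K * d / 2) * T%:R
  + enorm qq ^+ 2 * (n%:R / 2 * (T%:R `^ (1 - kappa) / (1 - kappa) + 1)
      + n%:R * (G ^+ 2 / (2 * sm)) * (T%:R `^ (1 - c) / (1 - c))).
Proof.
move=> Xy gy qq0.
have steps : \sum_(1 <= s < T.+1) (dot qq (tot_con s (x s))
    + (h s.+1 / 2 * N qq s.+1 - h s / 2 * N qq s)) <=
  \sum_(1 <= s < T.+1) (Num.sqrt n%:R * F * e s
     + a s.+1 * (D y s - D y s.+1)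
     + n%:R * (B1 ^+ 2 / 2) * gamma s.+1
     + n%:R * (8 * G ^+ 2 / sm + K * d / 2)
     + enorm qq ^+ 2 * (n%:R / 2 * beta s.+1
                        + n%:R * (G ^+ 2 / (2 * sm)) * alpha s.+1)).
  rewrite !big_nat; apply: ler_sum => s /andP[s0 sT].
  by apply: violation_step => // k; apply: gy; rewrite s0.
move: steps; rewrite [leLHS]big_split /= [leRHS]big_split /=.
rewrite [X in _ <= X + _]big_split /= [X in _ <= X + _ + _]big_split /=.
rewrite [X in _ <= X + _ + _ + _]big_split /=.
rewrite sumr_const_nat subSS subn0 -[(n%:R * _) *+ T]mulr_natr.
rewrite (telescope_sumr (fun s => h s / 2 * N qq s))// -dot_sumr.
have N1 : h 1%N / 2 * N qq 1%N = n%:R / 2 * enorm qq ^+ 2.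
  rewrite /h powR1 /N (eq_bigr (fun=> enorm qq ^+ 2)) => [|i _].
    by rewrite sumr_const card_ord -[_ *+ n]mulr_natl; ring.
  by rewrite dual1 sub0r enormN.
have hN : 0 <= h T.+1 / 2 * N qq T.+1.
  rewrite mulr_ge0 ?divr_ge0 ?powR_ge0//.
  by apply: sumr_ge0 => i _; exact: sqr_ge0.
have cons := consensus_cost_le T.
have breg := sum_bregman_le T Xy.
have gam : \sum_(1 <= s < T.+1) gamma s.+1 <= T%:R `^ kappa / kappa.
  by apply: ler_sum_succ => //; rewrite ?subr_ge0 ltW.
have alp : \sum_(1 <= s < T.+1) alpha s.+1 <= T%:R `^ (1 - c) / (1 - c).
  by apply: ler_sum_succ => //; rewrite ?subr_gt0 ?subKr// ?lerBlDr ?lerDl ltW.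
have bet : \sum_(1 <= s < T.+1) beta s.+1 <= T%:R `^ (1 - kappa) / (1 - kappa).
  by apply: ler_sum_succ => //; rewrite ?subr_gt0 ?subKr// ?lerBlDr ?lerDl ltW.
have {gam} gam : n%:R * (B1 ^+ 2 / 2) * (\sum_(1 <= s < T.+1) gamma s.+1) <=
    n%:R * (B1 ^+ 2 / 2) * (T%:R `^ kappa / kappa).
  by rewrite ler_wpM2l// mulr_ge0// divr_ge0 ?sqr_ge0.
have {alp} alp : n%:R * (G ^+ 2 / (2 * sm)) * (\sum_(1 <= s < T.+1) alpha s.+1) <=
    n%:R * (G ^+ 2 / (2 * sm)) * (T%:R `^ (1 - c) / (1 - c)).
  rewrite ler_wpM2l// mulr_ge0// divr_ge0 ?mulr_ge0 ?sqr_ge0//; exact: ltW.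
have {bet} bet : n%:R / 2 * (\sum_(1 <= s < T.+1) beta s.+1) <=
    n%:R / 2 * (T%:R `^ (1 - kappa) / (1 - kappa)).
  by rewrite ler_wpM2l// divr_ge0.
have bound := ler_wpM2l (sqr_ge0 (enorm qq)) (lerD bet alp).
rewrite !mulr_sumr -big_split /= mulr_sumr in bound.
rewrite mulr_sumr in cons; rewrite mulr_sumr in gam.
rewrite N1 /M0 -/(a T.+1); lra.
Qed.

End Run.

(** * Comparison with the stated constants *)

Lemma vmin_le (R : realType) (n : nat) (n_gt0 : (0 < n)%N) (a : 'I_n -> R) i :
  vmin n_gt0 a <= a i.
Proof. exact: bigmin_le. Qed.

Lemma vmin_gt0 (R : realType) (n : nat) (n_gt0 : (0 < n)%N) (a : 'I_n -> R) :
  (forall i, 0 < a i) -> 0 < vmin n_gt0 a.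
Proof. by move=> a0; exact: lt_bigmin. Qed.

(** The constant [B4] as a natural number: [t >= mu^(-1/kappa)] is equivalent to
    [t^kappa >= 1 / mu]. *)
Lemma exists_strong_threshold (R : realType) (mu kappa : R) :
  0 < mu -> 0 < kappa ->
  exists2 B : nat, (0 < B)%N /\
    B%:R = (Num.ceil (mu `^ (- (1 / kappa))))%:~R :> R &
    forall t, (B <= t)%N -> 1 / t%:R `^ kappa <= mu.
Proof.
move=> mu0 k0; set r := mu `^ _.
have r0 : 0 < r by rewrite powR_gt0.
have : 0 < Num.ceil r by rewrite ceil_gt0.
case: (Num.ceil r) (ceil_ge r) => // B rB B0; exists B => // t Bt.
have rt : r <= t%:R by rewrite (le_trans rB)// ler_nat.
have t0 : 0 < t%:R :> R by rewrite (lt_le_trans r0).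
rewrite div1r -[leRHS]invrK lef_pV2 ?posrE ?powR_gt0 ?invr_gt0//.
have -> : mu^-1 = r `^ kappa.
  rewrite /r -powRrM mulNr div1r mulVf ?gt_eqF// powR_inv1//; exact: ltW.
by apply: ge0_ler_powR; rewrite ?nnegrE//; exact: ltW.
Qed.

Theorem theorem3 (R : realType) (n m : nat) (n_gt0 : (0 < n)%N)
    (P : problem R n m) (sigma mu : 'I_n -> R)
    (E : nat -> rel 'I_n) (W : nat -> 'M[R]_n) (w : R) (iota : nat)
    (F G K d kappa : R) (Phi : self_maps P)
    (x xt : nat -> profile P) (q : nat -> 'I_n -> 'cV[R]_m)
    (Hstanding : standing_assumption P sigma)
    (Hgraph : graph_assumption E W w iota)
    (Hfun : function_assumption P F G)
    (Hlip : bregman_lipschitz P K)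
    (Hdom : preserves_dom Phi)
    (Hcontr : contractive Phi)
    (Hslater : slater P)
    (Hsc : strongly_convex_losses P mu)
    (Hd : 0 < d)
    (Hdiam : forall y z : profile P, inX y -> inX z -> pdist y z <= d)
    (Hkappa : 0 < kappa < 1)
    (HPhi : forall i t z, (0 < t)%N -> dom P i z -> Phi i t z = z) :
  let c := Num.max (1 - kappa) kappa in
  let alpha := fun t : nat => 1 / t%:R `^ c in
  let beta := fun t : nat => 1 / t%:R `^ kappa in
  let gamma := fun t : nat => 1 / t%:R `^ (1 - kappa) in
  let sigma_min := vmin n_gt0 sigma in
  let mu_min := vmin n_gt0 mu in
  let N : R := n%:R in
  let tau := ((1 - w / (2 * N ^+ 2)) ^+ 2)^-1 in
  let lambda := (1 - w / (2 * N ^+ 2)) `^ (1 / iota%:R) in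
  let B1 := 2 * F + G * d in
  let C11 := 3 * N ^+ 2 * tau * B1 * F / (1 - lambda) + N * B1 ^+ 2 / 2 in
  let C12 := 4 * N * G ^+ 2 / sigma_min in
  let B4 : R := (Num.ceil (mu_min `^ (- (1 / kappa))))%:~R in
  let C1 := C11 / kappa + C12 / (1 - c) + 2 * N * d * K in
  let C4 := N * B1 ^+ 2 / (2 * kappa) + B1 * C11 / kappa + C12 / kappa
            + 2 * N * d * K * B4 `^ (1 - kappa) in
  let C21 := 2 * N * (2 * G ^+ 2 / ((1 - c) * sigma_min)
                      + 1 / (1 - kappa) + 2) in
  let C2 := C21 * (2 * N * F + C1) in
  algorithm_run W Phi alpha beta gamma x xt q ->
  forall T : nat, (0 < T)%N ->
    (forall y : nat -> profile P, static_optimal T y ->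
       regret T x y <= Num.max C1 C4 * T%:R `^ kappa) /\
    enorm (pos (\sum_(1 <= t < T.+1) tot_con t (x t)))
      <= Num.sqrt C2 * T%:R `^ (1 - kappa / 2).

Proof.
move=> c alpha beta gamma sm mm N tau lambda B1 C11 C12 B4 C1 C4 C21 C2 run T T0.
have /andP[k0 k1] := Hkappa.
have [psi_m feas] : mirror_map P sigma /\
   forall T, (0 < T)%N -> @static_feasible R n m P T !=set0 by case: Hstanding.
have sm0 : 0 < sm by apply: vmin_gt0 => i; have [] := psi_m i.
have mm0 : 0 < mm by apply: vmin_gt0 => i; have [] := Hsc i.
have sm_le i : sm <= sigma i := vmin_le n_gt0 sigma i.
have mm_le i : mm <= mu i := vmin_le n_gt0 mu i.
have [w01 iota0 gr] := Hgraph.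
have dsW t : (0 < t)%N -> doubly_stochastic (W t) by move=> /gr[].
have c1 : c < 1 by rewrite gt_max k1 andbT ltrBlDr ltrDl.
have kc : kappa <= c by rewrite le_max lexx orbT.
have kc' : 1 - kappa <= c by rewrite le_max lexx.
have c2 : 1 / 2 <= c by lra.
have c01 : 0 < c < 1 by rewrite c1 andbT; lra.
have F0 := fa_F_gt0 Hfun; have G0 := fa_G_gt0 Hfun.
have [K0 _] := Hlip.
have N1 : 1 <= N by rewrite ler1n.
have T1 : 1 <= T%:R :> R by rewrite ler1n.
set M0 := N ^+ 4 * iota%:R * F * B1 / w.
set M := 3 * N ^+ 2 * tau * B1 * F / (1 - lambda).
have n2 : 0 < N ^+ 2 by rewrite exprn_gt0// (lt_le_trans ltr01).
have N0 : 0 <= N by exact: le_trans N1.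
have B1_gt0 : 0 < B1 by rewrite addr_gt0 ?mulr_gt0.
have [/andP[w0 _] _ _] := Hgraph.
have [lam1 tau_ge] := tau_lambda_ge w01 n_gt0 iota0.
have M0_ge0 : 0 <= M0.
  rewrite divr_ge0 ?(ltW w0)// !mulr_ge0 ?exprn_ge0 ?(ltW F0) ?(ltW B1_gt0)//.
have M0_le : 6 * M0 <= M.
  have -> : 6 * M0 = 3 * N ^+ 2 * B1 * F * (2 * N ^+ 2 * iota%:R / w).
    by rewrite /M0; ring.
  have -> : M = 3 * N ^+ 2 * B1 * F * (tau / (1 - lambda)) by rewrite /M; ring.
  apply: ler_wpM2l tau_ge.
  by rewrite !mulr_ge0 ?(ltW n2) ?(ltW F0) ?(ltW B1_gt0).
have powT (r s : R) : r <= s -> T%:R `^ r <= T%:R `^ s.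
  by move=> rs; exact: (ler_powR T1 rs).
have Tk1 : 1 <= T%:R `^ kappa by rewrite -[leLHS](powRr0 T%:R) powT// ltW.
have TkT : T%:R `^ kappa <= T%:R :> R by rewrite ler1_powR// ltW.
have Tck : T%:R `^ (1 - c) <= T%:R `^ kappa by rewrite powT// lerBlDr -lerBlDl.
have Tck' : T%:R `^ (1 - c) <= T%:R `^ (1 - kappa) by rewrite powT// lerD2l lerN2.
have Tk1' : 1 <= T%:R `^ (1 - kappa) by rewrite -[leLHS](powRr0 T%:R) powT// subr_ge0 ltW.
have k_inv : 0 < kappa^-1 by rewrite invr_gt0.
(* Because [c >= 1/2]; this lets the [C12] part of [C1] dominate the term [8 * G^2 / sm] of the
   violation bound. *)
have c_inv : 2 <= (1 - c)^-1.
  by rewrite -[2]invrK lef_pV2 ?posrE ?invr_gt0 ?subr_gt0//; lra.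
have S0 : 0 < N * G ^+ 2 / sm.
  by rewrite divr_gt0// mulr_gt0 ?exprn_gt0// (lt_le_trans ltr01).
have KD : 0 <= N * d * K by rewrite !mulr_ge0 ?(ltW Hd) ?(ltW K0).
have NB : 0 <= N * B1 ^+ 2 / 2 by rewrite divr_ge0// mulr_ge0// sqr_ge0.
have consk : (M0 + N * (B1 ^+ 2 / 2)) * (T%:R `^ kappa / kappa) <=
    (M / 6 + N * B1 ^+ 2 / 2) / kappa * T%:R `^ kappa.
  rewrite mulrA mulrAC ler_wpM2r ?powR_ge0// ler_pM2r// mulrA lerD2r.
  by rewrite ler_pdivlMr// mulrC.
set Tk := T%:R `^ kappa in Tk1 TkT Tck consk *.
have Tk0 : 0 <= Tk by exact: le_trans Tk1.
have c0 : 0 < c by case/andP: c01.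
have c_inv0 : 0 <= (1 - c)^-1 by exact: le_trans c_inv.
have M_ge0 : 0 <= M by apply: le_trans M0_le; rewrite mulr_ge0.
have Mk := mulr_ge0 (mulr_ge0 M_ge0 (ltW k_inv)) Tk0.
have C1_le : C1 <= Num.max C1 C4 by rewrite le_max lexx.
have C4_le : C4 <= Num.max C1 C4 by rewrite le_max lexx orbT.
have C1E : C1 = (M + N * B1 ^+ 2 / 2) / kappa
    + 4 * (N * G ^+ 2 / sm) * (1 - c)^-1 + 2 * (N * d * K).
  by rewrite /C1 /C11 /C12 -/M; ring.
have C4E : C4 = N * B1 ^+ 2 / 2 / kappa + B1 * (M + N * B1 ^+ 2 / 2) / kappa
    + 4 * (N * G ^+ 2 / sm) / kappa + 2 * (N * d * K) * B4 `^ (1 - kappa).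
  by rewrite /C4 /C11 /C12 -/M; field; rewrite !gt_eqF.
split.
  move=> y [[z [Xz gz yz]] _].
  have -> : regret T x y = cum_loss T x - cum_loss T (fun=> z).
    congr (_ - _); rewrite /cum_loss !big_nat; apply: eq_bigr => t tT.
    by rewrite yz.
  have gz' t k : (1 <= t <= T)%N -> tot_con t z k 0 <= 0 by move=> /gz.
  have [cE|cE] : c = kappa \/ c = 1 - kappa.
    by rewrite /c; case: leP => _; [left|right].
    have gap : cum_loss T x - cum_loss T (fun=> z) <=
        (M0 + N * (B1 ^+ 2 / 2)) * (Tk / kappa)
        + N * (2 * G ^+ 2 / sm) * (T%:R `^ (1 - c) / (1 - c))
        + N * (K * d) * T.+1%:R `^ c.
      exact: (cum_loss_gap_convex_le n_gt0 psi_m Hfun Hlip Hdiam HPhi Hkappa dsW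
        run Hgraph Hsc sm0 sm_le mm_le c01 (ltW mm0) Xz gz').
    apply: (le_trans gap); apply: le_trans (ler_wpM2r Tk0 C1_le).
    (* The shift from [T] to [T + 1] costs at most the factor 2 in [2 * N * d * K]. *)
    have T2 : T.+1%:R `^ c <= 2 * Tk.
      apply: (@le_trans _ _ ((2 * T%:R) `^ c)).
        apply: ge0_ler_powR; rewrite ?nnegrE ?mulr_ge0//; first exact: (ltW c0).
        by rewrite -natr1; lra.
      rewrite powRM// cE ler_wpM2r ?powR_ge0//.
      by rewrite ler1_powR ?ler1n// ltW.
    have := ler_wpM2l KD T2.
    have := ler_wpM2l (mulr_ge0 (mulr_ge0 (ler0n R 2) (ltW S0)) c_inv0) Tck.
    have -> : N * (2 * G ^+ 2 / sm) * (T%:R `^ (1 - c) / (1 - c)) =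
      2 * (N * G ^+ 2 / sm) * (1 - c)^-1 * T%:R `^ (1 - c) by ring.
    have SP := mulr_ge0 (mulr_ge0 (ltW S0) c_inv0) Tk0.
    move: gap consk; rewrite C1E; lra.
  have [B [B_gt0 BE] Bmm] := exists_strong_threshold mm0 k0.
  have ic : 1 - c = kappa by rewrite cE subKr.
  have gap : cum_loss T x - cum_loss T (fun=> z) <=
      (M0 + N * (B1 ^+ 2 / 2)) * (Tk / kappa)
      + N * (2 * G ^+ 2 / sm) * (T%:R `^ (1 - c) / (1 - c))
      + N * (K * d) * B%:R `^ c.
    exact: (cum_loss_gap_strong_le n_gt0 psi_m Hfun Hlip Hdiam HPhi Hkappa dsW
      run Hgraph Hsc sm0 sm_le mm_le c01 (ltW mm0) Xz gz' cE B_gt0 Bmm).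
  apply: (le_trans gap).
  (* Half of [C1] covers the consensus term, as [M / 6 <= M / 2]; half of [C4] covers
     [N * d * K * B4^(1 - kappa)]; the term [N * B1^2 / 2] takes one half from each. *)
  apply: (@le_trans _ _ ((C1 + C4) / 2 * Tk)); last first.
    by rewrite ler_wpM2r// ler_pdivrMr// mulr2n mulrDr mulr1 lerD.
  have -> : N * (2 * G ^+ 2 / sm) * (T%:R `^ (1 - c) / (1 - c)) =
    2 * (N * G ^+ 2 / sm) / kappa * Tk by rewrite ic -/Tk; ring.
  have SP := mulr_ge0 (mulr_ge0 (ltW S0) (ltW k_inv)) Tk0.
  have KP := mulr_ge0 KD Tk0.
  have KQ : N * d * K * B4 `^ (1 - kappa) <= N * d * K * B4 `^ (1 - kappa) * Tk.
    by rewrite ler_peMr// mulr_ge0// powR_ge0.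
  have BC := mulr_ge0 (mulr_ge0 (mulr_ge0 (ltW B1_gt0) (addr_ge0 M_ge0 NB)) (ltW k_inv)) Tk0.
  move: gap consk; rewrite C1E C4E BE -/B4 cE subKr; lra.
(* Any static feasible point serves as comparator for the violation. *)
have [_ [z [Xz gz _]]] := feas T T0.
have gz' t k : (1 <= t <= T)%N -> tot_con t z k 0 <= 0 by move=> /gz.
set S := \sum_(_ <= _ < _) _.
set r := enorm (pos S) ^+ 2.
set Th := T%:R `^ (1 - kappa) in Tck' Tk1'.
have Th0 : 0 < Th by exact: lt_le_trans Tk1'.
have k1_inv : 1 <= (1 - kappa)^-1 by rewrite invf_ge1 ?subr_gt0//; lra.
have sm_inv : 0 < sm^-1 by rewrite invr_gt0.
have c1' : 1 - c != 0 by rewrite subr_eq0 gt_eqF.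
have k1' : 1 - kappa != 0 by rewrite subr_eq0 gt_eqF.
have C21E : C21 = 4 * ((1 - c)^-1 * (N * G ^+ 2 / sm))
    + 2 * N * (1 - kappa)^-1 + 4 * N.
  by rewrite /C21; field; rewrite k1' c1' gt_eqF.
have Sc := mulr_ge0 c_inv0 (ltW S0).
have Nk := mulr_ge0 N0 (le_trans ler01 k1_inv).
have C21_ge : 4 * N <= C21 by rewrite C21E; lra.
have C21_gt0 : 0 < C21 by lra.
have C1_ge0 : 0 <= C1.
  rewrite C1E; have := mulr_ge0 (addr_ge0 M_ge0 NB) (ltW k_inv); lra.
have NF : 0 <= 2 * N * F by rewrite !mulr_ge0 ?(ltW F0).
have C2_ge0 : 0 <= C2 := mulr_ge0 (ltW C21_gt0) (addr_ge0 NF C1_ge0).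
suff r_le : r <= C2 * (Th * T%:R).
  have -> : T%:R `^ (1 - kappa / 2) = Num.sqrt (Th * T%:R).
    have -> : Th * T%:R = (T%:R `^ (1 - kappa / 2)) ^+ 2.
      rewrite expr2 -powRD; last by rewrite (gt_eqF (lt_le_trans ltr01 T1)) implybT.
      rewrite -[X in Th * X](powRr1 (ler0n R T)) -powRD; last first.
        by rewrite (gt_eqF (lt_le_trans ltr01 T1)) implybT.
      by congr (_ `^ _); field.
    by rewrite sqrtr_sqr ger0_norm ?powR_ge0.
  by rewrite -sqrtrM// -[leLHS]ger0_norm ?enorm_ge0// -sqrtr_sqr ler_wsqrtr.
(* The estimate [T + 1 + T / 2 <= 2 * T] for the Bregman terms fails at [T = 1]. There
   [r <= (N * F)^2] suffices, since [C21 >= 4 * N] and [C1 >= 2 * N * F^2]. *)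
case: (ltnP 1 T) => T_gt1; last first.
  have T_eq1 : T = 1%N by apply/eqP; rewrite eqn_leq T_gt1.
  have SE : S = tot_con 1 (x 1%N) by rewrite /S T_eq1 big_nat1.
  have S_le : enorm (pos S) <= N * F.
    rewrite (le_trans (enorm_pos_le _))// SE (le_trans (enorm_sum _ _))//.
    rewrite /N mulr_natl -[n in _ *+ n]card_ord -sumr_const.
    apply: ler_sum => i _.
    by have [_ _] := fa_bounded Hfun (ltn0Sn 0) (run_dom HPhi run 1 i).
  have : r <= (N * F) ^+ 2 by rewrite lerXn2r ?nnegrE ?enorm_ge0 ?mulr_ge0 ?(ltW F0).
  have -> : C2 * (Th * T%:R) = C2 by rewrite /Th T_eq1 powR1 !mulr1.
  have C1_ge : 2 * (N * F ^+ 2) <= C1.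
    have B1F : (2 * F) ^+ 2 <= B1 ^+ 2.
      rewrite lerXn2r ?nnegrE ?mulr_ge0 ?(ltW F0) ?(ltW B1_gt0)//.
      by rewrite lerDl mulr_ge0// ltW.
    have NBk : N * B1 ^+ 2 / 2 <= N * B1 ^+ 2 / 2 / kappa.
      by rewrite ler_peMr// invf_ge1// ltW.
    have := ler_wpM2l N0 B1F; have := mulr_ge0 M_ge0 (ltW k_inv).
    rewrite C1E; lra.
  have NF2 : 0 <= 2 * (N * F ^+ 2) by rewrite mulr_ge0// mulr_ge0// sqr_ge0.
  have := ler_pM (mulr_ge0 (ler0n R 4) N0) NF2 C21_ge C1_ge.
  have := mulr_ge0 (ltW C21_gt0) NF.
  have := mulr_ge0 N0 (mulr_ge0 N0 (sqr_ge0 F)).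
  rewrite /C2; lra.
have T2 : 2 <= T%:R :> R by rewrite ler_nat.
set A := (M0 + N * (B1 ^+ 2 / 2)) * (Tk / kappa) + N * (K * d) * T.+1%:R `^ c
  + N * (8 * G ^+ 2 / sm + K * d / 2) * T%:R.
(* The Bregman terms add up to at most [N * d * K * (T + 1 + T / 2)], which is at most
   [2 * N * d * K * T] for [T >= 2]. *)
have A_le : A <= (2 * N * F + C1) * T%:R.
  have Tc : T.+1%:R `^ c <= T%:R + 1 :> R.
    by rewrite natr1 ler1_powR ?ler1n// ltW.
  have := ler_wpM2l KD Tc; have := ler_wpM2l KD T2.
  have MNk := mulr_ge0 (addr_ge0 M_ge0 NB) (ltW k_inv).
  have := ler_wpM2l MNk TkT.
  have := ler_wpM2l (mulr_ge0 (ltW S0) (ler0n R T)) c_inv.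
  have := mulr_ge0 NF (ler0n R T).
  rewrite /A C1E; lra.
set b := N / 2 * (Th / (1 - kappa) + 1)
  + N * (G ^+ 2 / (2 * sm)) * (T%:R `^ (1 - c) / (1 - c)).
(* An upper bound for [b] chosen so that [4 * bm] is exactly [C21 * Th]. *)
pose bm := C21 * Th / 4.
have bm0 : 0 < bm by rewrite divr_gt0// mulr_gt0.
have b_le : b <= bm.
  have := ler_wpM2l Sc Tck'; have := ler_wpM2l N0 Tk1'.
  have := mulr_ge0 Sc (ltW Th0).
  have -> : b = N / 2 * (Th / (1 - kappa) + 1)
      + (1 - c)^-1 * (N * G ^+ 2 / sm) * T%:R `^ (1 - c) / 2.
    by rewrite /b; field; rewrite k1' c1' gt_eqF.
  rewrite /bm C21E; lra.
(* The maximizer of [<qq, S> - bm * |qq|^2] over the orthant, with value [r / (4 * bm)]; hence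
   [r <= 4 * bm * A]. *)
pose qq := (2 * bm)^-1 *: pos S.
have qq0 k : 0 <= qq k 0.
  by rewrite mxE posE mulr_ge0 ?le_max ?lexx// invr_ge0 mulr_ge0// ltW.
have con : dot qq S <= A + enorm qq ^+ 2 * b.
  exact: (cum_con_le n_gt0 psi_m Hfun Hlip Hdiam HPhi Hkappa dsW run Hgraph
    sm0 sm_le c01 Xz gz' qq0).
have r0 : 0 <= r by exact: sqr_ge0.
have qqE : enorm qq ^+ 2 = r / (4 * bm ^+ 2).
  rewrite /qq enormZ exprMn real_normK ?num_real// -/r.
  by field; rewrite gt_eqF.
have := ler_wpM2l (sqr_ge0 (enorm qq)) b_le.
move: con; rewrite dotZl dot_pos -/r qqE => con rb.
have rA : r <= 4 * bm * A.
  have : 0 <= 4 * bm * (A + r / (4 * bm ^+ 2) * bm - (2 * bm)^-1 * r).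
    apply: mulr_ge0; first by rewrite mulr_ge0// ltW.
    by rewrite subr_ge0 (le_trans con)// lerD2l.
  have -> : 4 * bm * (A + r / (4 * bm ^+ 2) * bm - (2 * bm)^-1 * r) =
    4 * bm * A - r by field; rewrite gt_eqF.
  lra.
apply: (le_trans rA).
have -> : C2 * (Th * T%:R) = 4 * bm * ((2 * N * F + C1) * T%:R).
  by rewrite /C2 /bm; field.
by rewrite ler_pM2l// mulr_gt0.
Qed.
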